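(* Suppose Assumptions (A1)–(A4) below hold. Let $\{\boldsymbol{x}_{i,t}\}$ be generated by Algorithm DOMFW (described in the context) with a nondecreasing integer sequence $\{K_t\}$ and $\alpha_t=1/(\rho K_t)$, where $\rho\ge1$ is a constant. Then for $T\ge2$, $K_t\ge2$ and every $j\in\mathcal{V}$, $$\mathbf{Regret}_d^j(T)\le E_1+E_2H_T+E_3\sum_{t=1}^T\frac1{K_t},$$ where $E_1=\frac{n^2L_X\Gamma_1}{1-\sigma_1^{K_1}}\sum_{i=1}^n\|\boldsymbol{x}_{i,1}\|+nL_X\sum_{i=1}^n\|\boldsymbol{x}_{i,1}-\boldsymbol{x}_{avg,1}\|+nL_XM(1-e^{-1/\rho})^{-1}$, $E_2=2n(1-e^{-1/\rho})^{-1}$, $E_3=2M\left(\frac1\rho D_1+\frac1{\rho^2}D_2\right)(1-e^{-1/\rho})^{-1}+\frac{nG_XM^2}{2\rho}(1-e^{-1/\rho})^{-1}+\frac{n^2L_XM}{\rho}\left(\frac{n\Gamma_1}{\sigma_1(1-\sigma_1)(1-\sigma_1^{K_1})}+2\right)$, with $D_1=\left(\frac{2n\Gamma_1G_X}{1-\sigma_1}+G_X\right)\left(nM+\frac{n\Gamma_1}{1-\sigma_1}\sum_{j=1}^n(\|\boldsymbol{x}_{j,1}\|+M)\right)+\frac{n^2\Gamma_1L_X}{1-\sigma_1}$ and $D_2=\frac{2n^2\Gamma_1G_XM}{1-\sigma_1}\left(\frac{n\Gamma_1}{1-\sigma_1}+3\right)+2nMG_X$.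
   Context: Network: $n$ agents, $\mathcal{V}=\{1,\dots,n\}$, time-varying directed graphs $\mathcal{G}_t=(\mathcal{V},\mathcal{E}_t,A_t)$; $\mathcal{N}_i^{in}(t)=\{j:(j,i)\in\mathcal{E}_t\}\cup\{i\}$, $[A_t]_{ij}>0$ iff $j\in\mathcal{N}_i^{in}(t)$, else $0$. (A1): (a) there is $\zeta>0$ with $[A_t]_{ij}>\zeta$ whenever $[A_t]_{ij}>0$; (b) $\mathcal{G}_t$ strongly connected for all $t$; (c) each $A_t$ doubly stochastic. (A2): $\boldsymbol{X}\subset\mathbb{R}^d$ convex compact, diameter at most $M$. (A3): $|f_{i,t}(\boldsymbol{x})-f_{i,t}(\boldsymbol{z})|\le L_X\|\boldsymbol{x}-\boldsymbol{z}\|$ on $\boldsymbol{X}$. (A4): $f_{i,t}(\boldsymbol{x})-f_{i,t}(\boldsymbol{z})\le\langle\nabla f_{i,t}(\boldsymbol{z}),\boldsymbol{x}-\boldsymbol{z}\rangle+\frac{G_X}{2}\|\boldsymbol{x}-\boldsymbol{z}\|^2$ on $\boldsymbol{X}$. Losses $f_{i,t}$ convex, differentiable on $\boldsymbol{X}$; $F_t=\sum_if_{i,t}$; $\boldsymbol{x}_t^*\in\arg\min_{\boldsymbol{X}}F_t$. Dynamic regret of agent $j$: $\mathbf{Regret}_d^j(T)=\sum_{t=1}^TF_t(\boldsymbol{x}_{j,t})-\sum_{t=1}^TF_t(\boldsymbol{x}_t^* )$. Function variation: $H_T=\sum_{t=1}^{T-1}\max_{i\in\mathcal{V}}\max_{\boldsymbol{x}\in\boldsymbol{X}}|f_{i,t+1}(\boldsymbol{x})-f_{i,t}(\boldsymbol{x})|$.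 Algorithm DOMFW: initial points $\boldsymbol{x}_{i,1}\in\boldsymbol{X}$. For $t=1,\dots,T$: $\boldsymbol{x}_{i,t}^1=\boldsymbol{x}_{i,t}$; for $k=1,\dots,K_t$: $\hat{\boldsymbol{x}}_{i,t}^k=\sum_j[A_t]_{ij}\boldsymbol{x}_{j,t}^k$; $\overline{\nabla}f_{i,t}^1=\nabla f_{i,t}(\hat{\boldsymbol{x}}_{i,t}^1)$, and for $k\ge2$, $\overline{\nabla}f_{i,t}^k=\widehat{\nabla}f_{i,t}^{k-1}+\nabla f_{i,t}(\hat{\boldsymbol{x}}_{i,t}^k)-\nabla f_{i,t}(\hat{\boldsymbol{x}}_{i,t}^{k-1})$; $\widehat{\nabla}f_{i,t}^k=\sum_j[A_t]_{ij}\overline{\nabla}f_{j,t}^k$; $\boldsymbol{v}_{i,t}^k\in\arg\min_{\boldsymbol{x}\in\boldsymbol{X}}\langle\boldsymbol{x},\widehat{\nabla}f_{i,t}^k\rangle$; $\boldsymbol{x}_{i,t}^{k+1}=\hat{\boldsymbol{x}}_{i,t}^k+\alpha_t(\boldsymbol{v}_{i,t}^k-\hat{\boldsymbol{x}}_{i,t}^k)$. Then $\boldsymbol{x}_{i,t+1}=\boldsymbol{x}_{i,t}^{K_t+1}$. Notation: $\boldsymbol{x}_{avg,t}=\frac1n\sum_i\boldsymbol{x}_{i,t}$; $\sigma_1=1-\frac{\zeta}{4n^2}$, $\Gamma_1=\left(1-\frac{\zeta}{4n^2}\right)^{-1}$; $e$ is Euler's number. *)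

(* Defs.v *)
From HB Require Import structures.
From mathcomp Require Import all_boot all_order all_algebra.
From mathcomp Require Import all_classical all_reals all_analysis.
Set Implicit Arguments. Unset Strict Implicit. Unset Printing Implicit Defensive.
Import Order.TTheory GRing.Theory Num.Theory.
Import numFieldNormedType.Exports.
Local Open Scope classical_set_scope.
Local Open Scope ring_scope.

Section Defs.
Variable R : realType.

Definition dotv (d : nat) (x y : 'rV[R]_d) : R := \sum_(k < d) x ord0 k * y ord0 k.
Definition enorm (d : nat) (x : 'rV[R]_d) : R := Num.sqrt (dotv x x).

Definition convex_subset (d : nat) (X : set 'rV[R]_d) : Prop :=
  forall x y, X x -> X y -> forall l : R, 0 <= l <= 1 -> X (l *: x + (1 - l) *: y).

Definition convex_fun_on (d : nat) (X : set 'rV[R]_d) (f : 'rV[R]_d -> R) : Prop :=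
  forall x y, X x -> X y -> forall l : R, 0 <= l <= 1 ->
    f (l *: x + (1 - l) *: y) <= l * f x + (1 - l) * f y.

Definition is_gradient_on (d : nat) (X : set 'rV[R]_d) (f : 'rV[R]_d -> R)
  (g : 'rV[R]_d -> 'rV[R]_d) : Prop :=
  forall x, X x -> differentiable f x /\ forall h, 'd f x h = dotv (g x) h.

(* Assumption (A1) for one matrix A (graph G_t is induced by the support of A). *)
Definition A1_matrix (n : nat) (zeta : R) (A : 'M[R]_n) : Prop :=
  (forall i j, 0 <= A i j) /\
  (forall i, 0 < A i i) /\                                (* i in N_i^in(t) *)
  (forall i j, 0 < A i j -> zeta < A i j) /\
  (forall i j, connect [rel a b | 0 < A b a] i j) /\       (* (b): edge (a,b) iff [A]_{ba} > 0 *)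
  (forall i, \sum_(j < n) A i j = 1) /\
  (forall j, \sum_(i < n) A i j = 1).

Definition HT (n d : nat) (X : set 'rV[R]_d) (f : nat -> 'I_n -> 'rV[R]_d -> R) (T : nat) : R :=
  \sum_(1 <= t < T)
     \big[Num.max/0]_(i < n) sup [set `|f t.+1 i x - f t i x| | x in X].

Definition Fsum (n d : nat) (f : nat -> 'I_n -> 'rV[R]_d -> R) (t : nat) (x : 'rV[R]_d) : R :=
  \sum_(i < n) f t i x.

Definition sigma1 (n : nat) (zeta : R) : R := 1 - zeta / (4 * (n%:R) ^+ 2).
Definition Gamma1 (n : nat) (zeta : R) : R := (sigma1 n zeta)^-1.
Definition cexp (rho : R) : R := (1 - expR (- rho^-1))^-1.

Definition D1 (n d : nat) (zeta G L M : R) (x1 : 'I_n -> 'rV[R]_d) : R :=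
  let s := sigma1 n zeta in let g := Gamma1 n zeta in let nr := n%:R in
  (2 * nr * g * G / (1 - s) + G) *
    (nr * M + nr * g / (1 - s) * \sum_(j < n) (enorm (x1 j) + M))
  + nr ^+ 2 * g * L / (1 - s).

Definition D2 (n : nat) (zeta G M : R) : R :=
  let s := sigma1 n zeta in let g := Gamma1 n zeta in let nr := n%:R in
  2 * nr ^+ 2 * g * G * M / (1 - s) * (nr * g / (1 - s) + 3) + 2 * nr * M * G.

Definition E1 (n d : nat) (zeta L M rho : R) (K1 : nat) (x1 : 'I_n -> 'rV[R]_d) : R :=
  let s := sigma1 n zeta in let g := Gamma1 n zeta in let nr := n%:R in
  let xavg := nr^-1 *: \sum_(i < n) x1 i in
  nr ^+ 2 * L * g / (1 - s ^+ K1) * \sum_(i < n) enorm (x1 i)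
  + nr * L * \sum_(i < n) enorm (x1 i - xavg)
  + nr * L * M * cexp rho.

Definition E2 (n : nat) (rho : R) : R := 2 * n%:R * cexp rho.

Definition E3 (n d : nat) (zeta G L M rho : R) (K1 : nat) (x1 : 'I_n -> 'rV[R]_d) : R :=
  let s := sigma1 n zeta in let g := Gamma1 n zeta in let nr := n%:R in
  2 * M * (rho^-1 * D1 zeta G L M x1 + (rho ^+ 2)^-1 * D2 n zeta G M) * cexp rho
  + nr * G * M ^+ 2 / (2 * rho) * cexp rho
  + nr ^+ 2 * L * M / rho * (nr * g / (s * (1 - s) * (1 - s ^+ K1)) + 2).

End Defs.

(* Main.v *)
Require Import Defs.
From HB Require Import structures.
From mathcomp Require Import all_boot all_order all_algebra.
From mathcomp Require Import all_classical all_reals all_analysis.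
From mathcomp Require Import ring lra.
Import Order.TTheory GRing.Theory Num.Theory.
Import numFieldNormedType.Exports.
Local Open Scope classical_set_scope.
Local Open Scope ring_scope.

(** The regret of agent [j] splits into the regret of the network average and
    [n L] times the distance of agent [j] to that average.

    Mixing by a doubly stochastic [A] contracts the deviation from the average,
    in the Frobenius norm, by [sigma1]: the squared deviation drops by the sum
    of the row variances, and following a simple path between two agents bounds
    the difference of their values by these variances. This controls the
    disagreement of the iterates and, through gradient tracking, of the
    gradient estimates.

    For the average, smoothness and the Frank-Wolfe choice of [v] give
    [h_(k+1) <= (1 - alpha) h_k + alpha (tracking error) + n G M^2 alpha^2 / 2]
    for the optimality gap [h]; as [(1 - alpha)^K <= exp (- 1 / rho)], one round
    contracts the gap by [exp (- 1 / rho)] up to [O (1 / K_t)], and passing from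
    [F_t] to [F_(t+1)] costs twice the function variation.

    Smoothness is assumed on [X] only, so gradients are not Lipschitz in norm;
    they are so, with constant [2 G M], when tested against differences of
    points of [X], which is all that the argument uses. *)

(** * Frobenius inner product and norm *)

Section Frobenius.
Context {R : realType}.

(** Row vectors and the matrices that stack one row per agent share this inner product; the trace
    form gives bilinearity and lets factors be moved cyclically. *)
Definition fdot {m d : nat} (X Y : 'M[R]_(m, d)) : R := \tr (X *m Y^T).
Definition frob {m d : nat} (X : 'M[R]_(m, d)) : R := Num.sqrt (fdot X X).

Section FrobeniusTheory.
Context {m d : nat}.
Implicit Types (X Y Z : 'M[R]_(m, d)) (a : R).

Lemma fdotE X Y : fdot X Y = \sum_i \sum_j X i j * Y i j.
Proof.
by rewrite /fdot /mxtrace; apply: eq_bigr => i _; rewrite mxE;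
  apply: eq_bigr => j _; rewrite !mxE.
Qed.

Lemma fdotC X Y : fdot X Y = fdot Y X.
Proof. by rewrite /fdot -mxtrace_tr trmx_mul trmxK. Qed.

Lemma fdotDl X Y Z : fdot (X + Y) Z = fdot X Z + fdot Y Z.
Proof. by rewrite /fdot mulmxDl mxtraceD. Qed.

Lemma fdotZl a X Y : fdot (a *: X) Y = a * fdot X Y.
Proof. by rewrite /fdot -scalemxAl mxtraceZ. Qed.

Lemma fdotDr X Y Z : fdot X (Y + Z) = fdot X Y + fdot X Z.
Proof. by rewrite !(fdotC X) fdotDl. Qed.

Lemma fdotZr a X Y : fdot X (a *: Y) = a * fdot X Y.
Proof. by rewrite !(fdotC X) fdotZl. Qed.

Lemma fdot0l X : fdot 0 X = 0.
Proof. by rewrite /fdot mul0mx mxtrace0. Qed.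

Lemma fdot_suml (I : Type) (r : seq I) (F : I -> 'M[R]_(m, d)) Y :
  fdot (\sum_(i <- r) F i) Y = \sum_(i <- r) fdot (F i) Y.
Proof. exact: (big_morph (fdot^~ Y) (fun U V => fdotDl U V Y) (fdot0l Y)). Qed.

Lemma fdot_ge0 X : 0 <= fdot X X.
Proof.
by rewrite fdotE; apply: sumr_ge0 => i _; apply: sumr_ge0 => j _; rewrite -expr2 sqr_ge0.
Qed.

Lemma frob_ge0 X : 0 <= frob X. Proof. exact: sqrtr_ge0. Qed.

Lemma sqr_frob X : frob X ^+ 2 = fdot X X.
Proof. by rewrite sqr_sqrtr// fdot_ge0. Qed.

Lemma fdot_eq0 X : fdot X X = 0 -> X = 0.
Proof.
move=> /eqP; rewrite fdotE psumr_eq0 => [|i _]; last first.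
  by apply: sumr_ge0 => j _; rewrite -expr2 sqr_ge0.
move=> /allP h; apply/matrixP => i j; rewrite mxE.
have := h i (mem_index_enum i).
rewrite psumr_eq0 => [|k _]; last by rewrite -expr2 sqr_ge0.
by move=> /allP /(_ j (mem_index_enum j)); rewrite -expr2 sqrf_eq0 => /eqP.
Qed.

(** Cauchy-Schwarz, from expanding the square of [fdot Y Y *: X - fdot X Y *: Y] and cancelling one
    factor [fdot Y Y]. *)
Lemma fdot_le X Y : fdot X Y <= frob X * frob Y.
Proof.
have [X0|X_neq0] := eqVneq (fdot Y Y) 0.
  have Y0 : Y = 0 by exact: fdot_eq0.
  by rewrite Y0 fdotC fdot0l mulr_ge0 ?frob_ge0.
have Ygt0 : 0 < fdot Y Y by rewrite lt_def X_neq0 fdot_ge0.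
have h : fdot X Y ^+ 2 <= fdot X X * fdot Y Y.
  have := fdot_ge0 (fdot Y Y *: X + (- fdot X Y) *: Y).
  rewrite !(fdotDl, fdotDr, fdotZl, fdotZr) (fdotC Y X) => h.
  rewrite -(ler_pM2l Ygt0); move: h; set a := fdot X X; set b := fdot Y Y.
  set c := fdot X Y; move=> h; nra.
apply: (le_trans (ler_norm _)).
rewrite -(@ler_pXn2r _ 2)// ?nnegrE ?mulr_ge0 ?frob_ge0//.
by rewrite exprMn !sqr_frob real_normK ?num_real.
Qed.

Lemma ler_frobD X Y : frob (X + Y) <= frob X + frob Y.
Proof.
rewrite -(@ler_pXn2r _ 2)// ?nnegrE ?addr_ge0 ?frob_ge0// sqr_frob.
rewrite fdotDl !fdotDr (fdotC Y X) -!sqr_frob.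
by have := fdot_le X Y; nra.
Qed.

Lemma frobZ a X : frob (a *: X) = `|a| * frob X.
Proof.
by rewrite /frob fdotZl fdotZr mulrA -expr2 sqrtrM ?sqr_ge0// sqrtr_sqr.
Qed.

Lemma frobZ_ge0 a X : 0 <= a -> frob (a *: X) = a * frob X.
Proof. by move=> a0; rewrite frobZ ger0_norm. Qed.

Lemma frobN X : frob (- X) = frob X.
Proof. by rewrite -scaleN1r frobZ normrN1 mul1r. Qed.

Lemma ler_frobB X Y : frob (X - Y) <= frob X + frob Y.
Proof. by rewrite (le_trans (ler_frobD _ _))// frobN. Qed.

Lemma frob_eq0 X : frob X = 0 -> X = 0.
Proof. by move=> X0; apply: fdot_eq0; rewrite -sqr_frob X0 expr0n. Qed.

End FrobeniusTheory.

Lemma fdot_rows {m d : nat} (X Y : 'M[R]_(m, d)) :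
  fdot X Y = \sum_i fdot (row i X) (row i Y).
Proof.
rewrite fdotE; apply: eq_bigr => i _; rewrite fdotE big_ord1.
by apply: eq_bigr => j _; rewrite !mxE.
Qed.

Lemma fdot_cols {m d : nat} (X Y : 'M[R]_(m, d)) :
  fdot X Y = \sum_j fdot (col j X) (col j Y).
Proof.
rewrite fdotE exchange_big/=; apply: eq_bigr => j _; rewrite fdotE.
by apply: eq_bigr => i _; rewrite big_ord1 !mxE.
Qed.

Lemma frob_row_le {m d : nat} (X : 'M[R]_(m, d)) i : frob (row i X) <= frob X.
Proof.
rewrite ler_sqrt ?fdot_ge0// [leRHS]fdot_rows (bigD1 i)//= lerDl.
by apply: sumr_ge0 => k _; exact: fdot_ge0.
Qed.

(** The widths may differ because a column of scalar products of gradient differences will be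
    compared with a matrix of displacements. *)
Lemma frob_le_rows {m d e : nat} (c : R) (X : 'M[R]_(m, d)) (Y : 'M[R]_(m, e)) :
  0 <= c -> (forall i, frob (row i X) <= c * frob (row i Y)) ->
  frob X <= c * frob Y.
Proof.
move=> c0 h; rewrite -(@ler_pXn2r _ 2)// ?nnegrE ?mulr_ge0 ?frob_ge0//.
rewrite exprMn !sqr_frob !fdot_rows mulr_sumr; apply: ler_sum => i _.
rewrite -!sqr_frob -exprMn ler_pXn2r// ?nnegrE ?mulr_ge0 ?frob_ge0//.
Qed.

Lemma frob_le_sum_rows {m d : nat} (X : 'M[R]_(m, d)) :
  frob X <= \sum_i frob (row i X).
Proof.
have s0 : 0 <= \sum_i frob (row i X) by apply: sumr_ge0 => i _; exact: frob_ge0.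
rewrite -(@ler_pXn2r _ 2)// ?nnegrE ?frob_ge0// sqr_frob fdot_rows expr2 mulr_suml.
apply: ler_sum => i _; rewrite -sqr_frob expr2 ler_wpM2l ?frob_ge0//.
by rewrite (bigD1 i)//= lerDl; apply: sumr_ge0 => j _; exact: frob_ge0.
Qed.

Lemma dotvE {d : nat} (x y : 'rV[R]_d) : dotv x y = fdot x y.
Proof. by rewrite fdotE big_ord1. Qed.

Lemma enormE {d : nat} (x : 'rV[R]_d) : enorm x = frob x.
Proof. by rewrite /enorm dotvE. Qed.

End Frobenius.

(** * Contraction by a doubly stochastic matrix *)

Lemma sum_sqr_le {R : realType} {I : finType} (a : I -> R) :
  (\sum_i a i) ^+ 2 <= #|I|%:R * \sum_i a i ^+ 2.
Proof.
(* Cauchy-Schwarz against the all-ones vector, read off from the sum of all squared differences. *)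
have h : 0 <= \sum_i \sum_j (a i - a j) ^+ 2.
  by do 2![apply: sumr_ge0 => ? _]; exact: sqr_ge0.
have e : \sum_i \sum_j (a i - a j) ^+ 2 =
    2 * (#|I|%:R * \sum_i a i ^+ 2) - 2 * (\sum_i a i) ^+ 2.
  transitivity (\sum_i (#|I|%:R * a i ^+ 2 + \sum_j a j ^+ 2 - 2 * (\sum_j a j) * a i)).
    apply: eq_bigr => i _.
    rewrite (eq_bigr (fun j => a i ^+ 2 + a j ^+ 2 - 2 * a i * a j)).
      rewrite sumrB big_split/= sumr_const -mulr_sumr mulr_natl; ring.
    by move=> j _; ring.
  rewrite sumrB big_split/= sumr_const -!mulr_sumr -[_ *+ #|_|]mulr_natl.
  by rewrite expr2; ring.
by move: h; rewrite e subr_ge0 ler_pM2l.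
Qed.

Section Consensus.
Context {R : realType} {n : nat} {zeta : R} {A : 'M[R]_n}.
Hypotheses (zeta_gt0 : 0 < zeta) (A1 : A1_matrix zeta A).

Let A_ge0 i j : 0 <= A i j. Proof. by case: A1 => + _; apply. Qed.
Let A_row i : \sum_j A i j = 1. Proof. by have [_ [_ [_ [_ [+ _]]]]] := A1; apply. Qed.
Let A_col j : \sum_i A i j = 1. Proof. by have [_ [_ [_ [_ [_ +]]]]] := A1; apply. Qed.

Lemma zeta_lt1 (i : 'I_n) : zeta < 1.
Proof.
have [_ [Aii [Az _]]] := A1; apply: (lt_le_trans (Az _ _ (Aii i))).
by rewrite -(A_row i) (bigD1 i)//= lerDl; apply: sumr_ge0.
Qed.

(** The index rules out [n = 0], where the division by zero would make [sigma1] equal to 1. *)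
Lemma sigma1_itv (i : 'I_n) : 0 < sigma1 n zeta < 1.
Proof.
have n1 : 1 <= n%:R :> R by rewrite ler1n; case: n i => // -[].
have z1 := zeta_lt1 i.
have n2 : 0 < 4 * n%:R ^+ 2 :> R by nra.
rewrite /sigma1 subr_gt0 ltr_pdivrMr// mul1r; apply/andP; split; first by nra.
by rewrite ltrBlDr ltrDl divr_gt0.
Qed.

Section Scalar.
Variable y : 'I_n -> R.

(** Row [i] of [A] is a probability vector; [wavg] and [wvar] are the mean and the variance of [y]
    under it. *)
Definition wavg (i : 'I_n) : R := \sum_j A i j * y j.
Definition wvar (i : 'I_n) : R := \sum_j A i j * (y j - wavg i) ^+ 2.

Lemma wvar_ge0 i : 0 <= wvar i.
Proof. by apply: sumr_ge0 => j _; rewrite mulr_ge0 ?sqr_ge0. Qed.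

Lemma wvarE i : wvar i = \sum_j A i j * y j ^+ 2 - wavg i ^+ 2.
Proof.
rewrite /wvar (eq_bigr (fun j => A i j * y j ^+ 2 - 2 * wavg i * (A i j * y j)
  + wavg i ^+ 2 * A i j)); last by move=> j _; ring.
rewrite big_split/= sumrB -!mulr_sumr A_row -/(wavg i); ring.
Qed.

(** Each variance is a second moment minus a squared mean, and since columns sum to 1 the second
    moments add up to the squared norm of [y]. *)
Lemma sum_wavg_sqr : \sum_i wavg i ^+ 2 = \sum_j y j ^+ 2 - \sum_i wvar i.
Proof.
under [X in _ = _ - X]eq_bigr do rewrite wvarE.
rewrite sumrB exchange_big/=.
under [X in _ - (X - _)]eq_bigr do rewrite -mulr_suml A_col mul1r.
by rewrite opprB addrC subrK.
Qed.

Let c i := Num.sqrt (2 / zeta * wvar i).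

(* Both endpoints of the edge [a -> b] have weight at least [zeta] in row [b],
   the endpoint [b] through the self-loop. *)
Lemma edge_diff_le a b : 0 < A b a -> `|y a - y b| <= c b.
Proof.
move=> Aba; have [<-|ab] := eqVneq a b; first by rewrite subrr normr0 sqrtr_ge0.
have [_ [Aii [Az _]]] := A1.
have Hv : A b a * (y a - wavg b) ^+ 2 + A b b * (y b - wavg b) ^+ 2 <= wvar b.
  rewrite /wvar (bigD1 a)//= (bigD1 b) 1?eq_sym//= addrA lerDl.
  by apply: sumr_ge0 => j _; rewrite mulr_ge0 ?sqr_ge0.
have h1 := Az _ _ Aba; have h2 := Az _ _ (Aii b).
rewrite -sqrtr_sqr ler_sqrt; last first.
  by rewrite mulr_ge0 ?wvar_ge0// divr_ge0// ltW.
rewrite mulrAC ler_pdivlMr//; move: Hv h1 h2 zeta_gt0.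
move: (wavg b) (wvar b) (A b a) (A b b) (y a) (y b) => m v p q r s Hv h1 h2 z0.
have h3 : zeta * (r - m) ^+ 2 <= p * (r - m) ^+ 2 by rewrite ler_wpM2r ?sqr_ge0// ltW.
have h4 : zeta * (s - m) ^+ 2 <= q * (s - m) ^+ 2 by rewrite ler_wpM2r ?sqr_ge0// ltW.
have h5 : (r - s) ^+ 2 <= 2 * ((r - m) ^+ 2 + (s - m) ^+ 2).
  by have := sqr_ge0 ((r - m) + (s - m)); nra.
apply: (@le_trans _ _ (2 * ((r - m) ^+ 2 + (s - m) ^+ 2) * zeta)).
  by rewrite ler_wpM2r// ltW.
lra.
Qed.

Lemma diff_le_sum a b : `|y a - y b| <= \sum_i c i.
Proof.
have [_ [_ [_ [Ac _]]]] := A1.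
have /connectP[p pa ->] := Ac a b.
(* On a simple path each edge is charged to its endpoint, and no vertex is charged twice, so the sum
   of all [c i] suffices. *)
case/shortenP: pa => q qa qu _ {p}.
apply: (@le_trans _ _ (\sum_(i <- q) c i)); last first.
  move: qu => /= /andP[_ qu]; rewrite (big_uniq _ qu)/= big_mkcond/=.
  by apply: ler_sum => i _; case: ifP => // _; exact: sqrtr_ge0.
elim: q a qa {qu} => [|d q IH] a /=; first by rewrite big_nil subrr normr0.
move=> /andP[ad qd]; rewrite big_cons (le_trans (ler_distD (y d) _ _))//.
by rewrite lerD ?edge_diff_le ?IH.
Qed.

(** A Poincaré inequality. As [y] has mean zero, [n * y i] is the sum of the [y i - y j], so [y i]
    is at most the sum of the [c i] in absolute value. One factor [n] comes from squaring that sum,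
    the other from summing over [i]. *)
Lemma sum_sqr_le_wvar : \sum_i y i = 0 ->
  \sum_i y i ^+ 2 <= n%:R ^+ 2 * (2 / zeta * \sum_i wvar i).
Proof.
move=> y0; have z2 : 0 <= 2 / zeta by rewrite divr_ge0// ltW.
have C2 : (\sum_i c i) ^+ 2 <= n%:R * (2 / zeta * \sum_i wvar i).
  rewrite (le_trans (sum_sqr_le _))// card_ord ler_wpM2l// mulr_sumr.
  apply: ler_sum => i _; rewrite sqr_sqrtr// mulr_ge0 ?wvar_ge0//.
have yi i : y i ^+ 2 <= (\sum_i c i) ^+ 2.
  have n0 : 0 < n%:R :> R by rewrite ltr0n; case: n i => // -[].
  have c0 : 0 <= \sum_i c i by apply: sumr_ge0 => k _; exact: sqrtr_ge0.
  rewrite -[y i ^+ 2]real_normK ?num_real// ler_pXn2r// ?nnegrE//.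
  rewrite -(ler_pM2l n0) -[X in X * `|_|]ger0_norm// -normrM.
  have -> : n%:R * y i = \sum_j (y i - y j).
    by rewrite sumrB y0 subr0 sumr_const card_ord mulr_natl.
  rewrite (le_trans (ler_norm_sum _ _ _))//.
  rewrite (le_trans (ler_sum _ (fun j _ => diff_le_sum i j)))//.
  by rewrite sumr_const card_ord mulr_natl.
rewrite (le_trans (ler_sum _ (fun j _ => yi j)))// sumr_const card_ord.
by rewrite -[_ *+ n]mulr_natl [n%:R ^+ 2]expr2 -[leRHS]mulrA ler_wpM2l.
Qed.

Lemma sum_wavg_sqr_le : \sum_i y i = 0 ->
  \sum_i wavg i ^+ 2 <= sigma1 n zeta ^+ 2 * \sum_i y i ^+ 2.
Proof.
move=> y0; have := sum_sqr_le_wvar y0; rewrite sum_wavg_sqr.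
set S := \sum_i y i ^+ 2; set V := \sum_i wvar i => h.
have S0 : 0 <= S by apply: sumr_ge0 => i _; exact: sqr_ge0.
have [n0|n0] := posnP n.
  have -> : S = 0 by apply: big1 => i _; have := ltn_ord i; rewrite {2}n0.
  by rewrite mulr0 sub0r oppr_le0; apply: sumr_ge0 => i _; exact: wvar_ge0.
have n2 : 0 < n%:R ^+ 2 :> R by rewrite exprn_gt0// ltr0n.
have : zeta / (2 * n%:R ^+ 2) * S <= V.
  rewrite mulrAC ler_pdivrMr ?mulr_gt0 ?ltr0n//.
  move: h; rewrite -(ler_pM2l zeta_gt0).
  have -> : zeta * (n%:R ^+ 2 * (2 / zeta * V)) = V * (2 * n%:R ^+ 2).
    by field; rewrite gt_eqF.
  by [].
(* The loss of variance gives the factor [1 - zeta / (2 n^2)]; the 4 in [sigma1] makes this at most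
   a perfect square. *)
have e : sigma1 n zeta ^+ 2 = 1 - zeta / (2 * n%:R ^+ 2) + (zeta / (4 * n%:R ^+ 2)) ^+ 2.
  by rewrite /sigma1; field; rewrite pnatr_eq0 -lt0n.
rewrite e; have := sqr_ge0 (zeta / (4 * n%:R ^+ 2)).
move: (zeta / (2 * _)) ((zeta / (4 * _)) ^+ 2) => p q q0 hp.
nra.
Qed.

End Scalar.

Lemma frob_mul_le {d : nat} (Y : 'M[R]_(n, d)) : frob (A *m Y) <= frob Y.
Proof.
rewrite ler_sqrt ?fdot_ge0// !fdot_cols; apply: ler_sum => k _.
rewrite !fdotE.
rewrite (eq_bigr (fun i => wavg (Y ^~ k) i ^+ 2)); last first.
  by move=> i _; rewrite big_ord1 !mxE -expr2.
rewrite sum_wavg_sqr [leRHS](eq_bigr (fun i => Y i k ^+ 2)); last first.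
  by move=> i _; rewrite big_ord1 !mxE -expr2.
by rewrite gerBl; apply: sumr_ge0 => i _; exact: wvar_ge0.
Qed.

Lemma frob_mul_sigma1 {d : nat} (Y : 'M[R]_(n, d)) (i0 : 'I_n) :
  (forall k, \sum_i Y i k = 0) -> frob (A *m Y) <= sigma1 n zeta * frob Y.
Proof.
move=> Y0; have /andP[s0 _] := sigma1_itv i0.
rewrite -(@ler_pXn2r _ 2)// ?nnegrE ?mulr_ge0 ?frob_ge0 ?(ltW s0)//.
rewrite exprMn !sqr_frob !fdot_cols mulr_sumr; apply: ler_sum => k _.
rewrite !fdotE.
rewrite (eq_bigr (fun i => wavg (Y ^~ k) i ^+ 2)); last first.
  by move=> i _; rewrite big_ord1 !mxE -expr2.
rewrite [X in _ <= _ * X](eq_bigr (fun i => Y i k ^+ 2)); last first.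
  by move=> i _; rewrite big_ord1 !mxE -expr2.
exact: sum_wavg_sqr_le.
Qed.

End Consensus.

(** * Deviation from the network average *)

Section Deviation.
Context {R : realType} {n : nat}.

(** For [n > 0], the orthogonal projector onto configurations where all agents agree; [dev] is the
    complementary projector. A doubly stochastic matrix commutes with both. *)
Definition avgmx : 'M[R]_n := const_mx n%:R^-1.
Definition dev {d : nat} (Y : 'M[R]_(n, d)) : 'M[R]_(n, d) := Y - avgmx *m Y.
Definition avgr {d : nat} (Y : 'M[R]_(n, d)) : 'rV[R]_d := n%:R^-1 *: \sum_i row i Y.

Lemma row_avgmx {d : nat} (Y : 'M[R]_(n, d)) i : row i (avgmx *m Y) = avgr Y.
Proof.
rewrite row_mul mulmx_sum_row /avgr scaler_sumr.
by apply: eq_bigr => j _; rewrite !mxE.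
Qed.

Lemma row_dev {d : nat} (Y : 'M[R]_(n, d)) i : row i (dev Y) = row i Y - avgr Y.
Proof. by rewrite /dev linearB/= row_avgmx. Qed.

Lemma devD {d : nat} (Y Z : 'M[R]_(n, d)) : dev (Y + Z) = dev Y + dev Z.
Proof. by rewrite /dev mulmxDr opprD addrACA. Qed.

Lemma devZ {d : nat} a (Y : 'M[R]_(n, d)) : dev (a *: Y) = a *: dev Y.
Proof. by rewrite /dev -scalemxAr scalerBr. Qed.

Lemma dev_mulr {d e : nat} (Y : 'M[R]_(n, d)) (Z : 'M[R]_(d, e)) :
  dev (Y *m Z) = dev Y *m Z.
Proof. by rewrite /dev mulmxBl mulmxA. Qed.

Lemma avgrD {d : nat} (Y Z : 'M[R]_(n, d)) : avgr (Y + Z) = avgr Y + avgr Z.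
Proof.
rewrite /avgr -scalerDr -big_split/=; congr (_ *: _).
by apply: eq_bigr => i _; rewrite linearD.
Qed.

Lemma avgrZ {d : nat} a (Y : 'M[R]_(n, d)) : avgr (a *: Y) = a *: avgr Y.
Proof.
rewrite /avgr; under eq_bigr do rewrite linearZ/=.
by rewrite -scaler_sumr !scalerA mulrC.
Qed.

Lemma avgmx_idem (i0 : 'I_n) : avgmx *m avgmx = avgmx.
Proof.
apply/matrixP => i j; rewrite !mxE; under eq_bigr do rewrite !mxE.
rewrite sumr_const card_ord -[(_ * _) *+ _]mulr_natl mulrA divff ?mul1r// pnatr_eq0.
by rewrite -lt0n; exact: leq_ltn_trans (ltn_ord i0).
Qed.

Lemma sum_dev {d : nat} (i0 : 'I_n) (Y : 'M[R]_(n, d)) k : \sum_i dev Y i k = 0.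
Proof.
have : (avgmx *m dev Y) i0 k = 0.
  by rewrite /dev mulmxBr mulmxA (avgmx_idem i0) subrr mxE.
rewrite mxE; under eq_bigr do rewrite [avgmx _ _]mxE.
rewrite -mulr_sumr => /eqP; rewrite mulf_eq0 invr_eq0 pnatr_eq0 => /orP[/eqP n0|/eqP//].
by have := ltn_ord i0; rewrite {2}n0.
Qed.

(** Pythagoras: [dev Y] is orthogonal to [avgmx *m Y], because [avgmx] is symmetric and annihilates
    [dev Y]. *)
Lemma frob_dev_le {d : nat} (i0 : 'I_n) (Y : 'M[R]_(n, d)) : frob (dev Y) <= frob Y.
Proof.
rewrite ler_sqrt ?fdot_ge0//.
have e : Y = dev Y + avgmx *m Y by rewrite /dev subrK.
suff o : fdot (dev Y) (avgmx *m Y) = 0.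
  have -> : fdot Y Y = fdot (dev Y + avgmx *m Y) (dev Y + avgmx *m Y) by rewrite -e.
  move: (dev Y) (avgmx *m Y) o => D Z o.
  by rewrite !(fdotDl, fdotDr) (fdotC Z) o addr0 add0r lerDl fdot_ge0.
rewrite /fdot trmx_mul trmx_const -/avgmx mulmxA mxtrace_mulC mulmxA.
by rewrite {1}/dev mulmxBr mulmxA (avgmx_idem i0) subrr mul0mx mxtrace0.
Qed.

Context {zeta : R} {A : 'M[R]_n}.
Hypotheses (zeta_gt0 : 0 < zeta) (A1 : A1_matrix zeta A).

Lemma mulmx_avg : A *m avgmx = avgmx.
Proof.
have [_ [_ [_ [_ [Ar _]]]]] := A1.
apply/matrixP => i j; rewrite !mxE; under eq_bigr do rewrite mxE.
by rewrite -mulr_suml Ar mul1r.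
Qed.

Lemma avg_mulmx : avgmx *m A = avgmx.
Proof.
have [_ [_ [_ [_ [_ Ac]]]]] := A1.
apply/matrixP => i j; rewrite !mxE; under eq_bigr do rewrite mxE.
by rewrite -mulr_sumr Ac mulr1.
Qed.

Lemma dev_mul {d : nat} (Y : 'M[R]_(n, d)) : dev (A *m Y) = A *m dev Y.
Proof. by rewrite /dev mulmxBr !mulmxA mulmx_avg avg_mulmx. Qed.

Lemma avgr_mul {d : nat} (i0 : 'I_n) (Y : 'M[R]_(n, d)) : avgr (A *m Y) = avgr Y.
Proof. by rewrite -!(row_avgmx _ i0) mulmxA avg_mulmx. Qed.

Lemma frob_dev_mul {d : nat} (i0 : 'I_n) (Y : 'M[R]_(n, d)) :
  frob (dev (A *m Y)) <= sigma1 n zeta * frob (dev Y).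
Proof.
by rewrite dev_mul (frob_mul_sigma1 zeta_gt0 A1)// => k; exact: sum_dev.
Qed.

(** [A] fixes the average part, so only the deviation moves; the 2 is the triangle inequality with
    [A] nonexpansive. *)
Lemma frob_mul_sub {d : nat} (Y : 'M[R]_(n, d)) :
  frob (A *m Y - Y) <= 2 * frob (dev Y).
Proof.
have -> : A *m Y - Y = A *m dev Y - dev Y.
  by rewrite /dev mulmxBr mulmxA mulmx_avg opprB addrA subrK.
rewrite (le_trans (ler_frobB _ _))// mulrDl mul1r lerD2r.
exact: (frob_mul_le A1).
Qed.

End Deviation.

(** * Convex combinations *)

Section ConvexSet.
Context {R : realType} {d : nat} {X : set 'rV[R]_d}.
Hypothesis Xconv : convex_subset X.

Lemma convex_comb (I : finType) (w : I -> R) (x : I -> 'rV[R]_d) :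
  (forall i, 0 <= w i) -> \sum_i w i = 1 -> (forall i, X (x i)) ->
  X (\sum_i w i *: x i).
Proof.
move=> w0 w1 xX.
have [i0 _] : exists i : I, True.
  apply: contrapT => h; have /eqP := w1; rewrite big1 => [|i _].
    by rewrite eq_sym oner_eq0.
  by exfalso; apply: h; exists i.
(* The invariant writes a partial sum as its total weight times a point of [X], which stays
   meaningful when that weight is zero. *)
suff : 0 <= \sum_i w i /\ exists2 z, X z & \sum_i w i *: x i = (\sum_i w i) *: z.
  by rewrite w1 => -[_ [z Xz ->]]; rewrite scale1r.
elim/big_ind2: _ => [|s u s' u' [s0 [z Xz ->]] [s0' [z' Xz' ->]]|i _].
- by split => //; exists (x i0) => //; rewrite scale0r.
- split; first exact: addr_ge0.
  have [e|ne] := eqVneq (u + u') 0.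
    exists z => //; have /eqP := e; rewrite paddr_eq0// => /andP[/eqP -> /eqP ->].
    by rewrite addr0 !scale0r addr0.
  have p : 0 < u + u' by rewrite lt_def ne addr_ge0.
  exists ((u / (u + u')) *: z + (1 - u / (u + u')) *: z').
    apply: Xconv => //; rewrite divr_ge0 ?addr_ge0//= ler_pdivrMr// mul1r lerDl//.
  rewrite scalerDr !scalerA; congr (_ *: _ + _ *: _); field; exact: ne.
- by split => //; exists (x i).
Qed.

Lemma convex_step (x y : 'rV[R]_d) (l : R) : X x -> X y -> 0 <= l <= 1 ->
  X (x + l *: (y - x)).
Proof.
move=> Xx Xy l01; have -> : x + l *: (y - x) = l *: y + (1 - l) *: x.
  by rewrite scalerBr scalerBl scale1r addrCA.
exact: Xconv.
Qed.

End ConvexSet.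

(** * Gradients tested against directions inside the feasible set *)

Section GradientBounds.
Context {R : realType} {d : nat} {X : set 'rV[R]_d} {f : 'rV[R]_d -> R}.
Context {g : 'rV[R]_d -> 'rV[R]_d} {M L G : R}.
Hypotheses (Xconv : convex_subset X)
  (Xdiam : forall y z, X y -> X z -> enorm (y - z) <= M)
  (L0 : 0 <= L) (G0 : 0 <= G) (M0 : 0 <= M)
  (flip : forall y z, X y -> X z -> `|f y - f z| <= L * enorm (y - z))
  (fsmooth : forall y z, X y -> X z ->
     f y - f z <= dotv (g z) (y - z) + G / 2 * enorm (y - z) ^+ 2)
  (fconv : convex_fun_on X f) (fgrad : is_gradient_on X f g).

(** Convexity bounds every difference quotient with step in (0, 1] by [f y - f x]; the directional
    derivative is their limit. *)
Lemma gradient_ineq x y : X x -> X y -> fdot (g x) (y - x) <= f y - f x.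
Proof.
move=> Xx Xy; have [fd fg] := fgrad _ Xx.
have -> : fdot (g x) (y - x) = 'D_(y - x) f x by rewrite deriveE// fg dotvE.
have /cvgrPdist_le cv : derivable f x (y - x) by exact: diff_derivable.
apply/ler_addgt0Pr => e e0.
have := cv _ e0; rewrite /dnbhs /within/= => /nbhs_ballP[r /= r0 H].
(* Below [r] the quotient is within [e] of the derivative; the cap 1 keeps the point on the
   segment. *)
pose h := Num.min (r / 2) 1.
have h0 : 0 < h by rewrite lt_min ltr01 divr_gt0.
have h1 : h <= 1 by rewrite ge_min lexx orbT.
have hr : h < r by rewrite gt_min; apply/orP; left; rewrite ltr_pdivrMr// ltr_pMr// ltr1n.
have := H h; rewrite -ball_normE/= sub0r normrN gtr0_norm// => /(_ hr (lt0r_neq0 h0)).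
rewrite -/(derive f x (y - x)) => {}H.
have : h^-1 *: (f (h *: (y - x) + x) - f x) <= f y - f x.
  rewrite /GRing.scale/= mulrC ler_pdivrMr//.
  have := fconv _ _ Xy Xx h.
  rewrite (ltW h0) h1 => /(_ isT).
  have -> : h *: y + (1 - h) *: x = h *: (y - x) + x.
    by rewrite scalerBr scalerBl scale1r addrA addrAC.
  by move=> ?; nra.
by move: H; rewrite ler_distl => /andP[_]; lra.
Qed.

(** The direction is [(y - a) - (z - a)]. Convexity and the Lipschitz bound cap the slope towards
    [y] by [L * M]; smoothness along a short step towards [z] bounds the slope there below by
    [- (L * M)]. *)
Lemma gradient_dot_le a y z : X a -> X y -> X z ->
  `|fdot (g a) (y - z)| <= 2 * L * M.
Proof.
suff h : forall a y z, X a -> X y -> X z -> fdot (g a) (y - z) <= 2 * L * M.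
  move=> Xa Xy Xz; rewrite ler_norml h// andbT lerNl.
  by rewrite -[X in X <= _]mulN1r -fdotZr scaleN1r opprB h.
move=> {}a {}y {}z Xa Xy Xz.
have LM u w : X u -> X w -> L * enorm (u - w) <= L * M.
  by move=> Xu Xw; rewrite ler_wpM2l// Xdiam.
have up : fdot (g a) (y - a) <= L * M.
  rewrite (le_trans (gradient_ineq _ _ Xa Xy))// (le_trans (ler_norm _))//.
  by rewrite (le_trans (flip _ _ Xy Xa))// LM.
have lo : - (L * M) <= fdot (g a) (z - a).
  apply/ler_addgt0Pr => e e0.
  pose c := G / 2 * enorm (z - a) ^+ 2.
  have c0 : 0 <= c by rewrite mulr_ge0 ?sqr_ge0// divr_ge0.
  (* The step makes the quadratic term, divided by [l], at most [e]; [c + 1] avoids dividing by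
     zero. *)
  pose l := Num.min (e / (c + 1)) 1.
  have l0 : 0 < l by rewrite lt_min ltr01 divr_gt0// ltr_wpDl.
  have l1 : l <= 1 by rewrite ge_min lexx orbT.
  have lc : l * c <= e.
    rewrite (@le_trans _ _ (e / (c + 1) * c))// ?ler_wpM2r// ?ge_min ?lexx//.
    by rewrite mulrAC ler_pdivrMr ?ltr_wpDl// ler_wpM2l ?lerDl// ltW.
  have Xl : X (a + l *: (z - a)) by apply: convex_step => //; rewrite ltW.
  have := fsmooth _ _ Xl Xa; have := flip _ _ Xl Xa.
  rewrite [a + _ - a]addrAC subrr add0r enormE frobZ_ge0 ?(ltW l0)// -enormE dotvE fdotZr.
  rewrite ler_norml => /andP[h1 _] h2.
  have h3 := LM _ _ Xz Xa.
  rewrite -(ler_pM2l l0); move: h1 h2 h3; rewrite exprMn.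
  have -> : G / 2 * (l ^+ 2 * enorm (z - a) ^+ 2) = l * (l * c) by rewrite /c; ring.
  move=> h1 h2 h3.
  have : l * (l * c) <= l * e by rewrite ler_wpM2l// ltW.
  have : l * (L * enorm (z - a)) <= l * (L * M) by rewrite ler_wpM2l// ltW.
  nra.
have -> : y - z = (y - a) + (-1) *: (z - a) by rewrite scaleN1r opprB addrA subrK.
by rewrite fdotDr fdotZr; lra.
Qed.

(* The upper quadratic model at [a] and [b] is compared with the tangent planes
   of [b] and [a] at points that move from [a] towards [z] and from [b] towards
   [y]; both stay in [X], so that smoothness on [X] alone suffices. *)
Lemma gradient_lipschitz a b y z : X a -> X b -> X y -> X z ->
  fdot (g a - g b) (y - z) <= 2 * G * M * frob (a - b).
Proof.
move=> Xa Xb Xy Xz.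
have [/frob_eq0 ab|ab] := eqVneq (frob (a - b)) 0.
  have -> : g a - g b = 0 by move/eqP: ab; rewrite subr_eq0 => /eqP ->; rewrite subrr.
  by rewrite fdot0l !mulr_ge0 ?frob_ge0.
have p0 : 0 < frob (a - b) by rewrite lt_def ab frob_ge0.
have pM : frob (a - b) <= M by rewrite -enormE Xdiam.
have M_gt0 : 0 < M by exact: lt_le_trans pM.
(* With this step [tau * M] equals [frob (a - b)]: the quadratic terms become of order
   [frob (a - b) ^+ 2], and dividing by [tau] leaves a bound linear in [frob (a - b)]. The diameter
   bound gives [tau <= 1]. *)
pose tau := frob (a - b) / M.
have tau0 : 0 < tau by rewrite divr_gt0.
have tau1 : tau <= 1 by rewrite ler_pdivrMr// mul1r.
have t01 : 0 <= tau <= 1 by rewrite ltW.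
have Xaz : X (a + tau *: (z - a)) by exact: convex_step.
have Xby : X (b + tau *: (y - b)) by exact: convex_step.
have I1 : fdot (g a - g b) (tau *: (y - b) - tau *: (z - a)) <=
    fdot (g a - g b) (a - b)
    + G / 2 * (frob (tau *: (z - a)) ^+ 2 + frob (tau *: (y - b)) ^+ 2).
  move: (tau *: (y - b)) (tau *: (z - a)) Xaz Xby => w' w Xaw Xbw'.
  have := fsmooth _ _ Xaw Xa; have := gradient_ineq _ _ Xb Xaw.
  have := fsmooth _ _ Xbw' Xb; have := gradient_ineq _ _ Xa Xbw'.
  have -> : a + w - a = w by rewrite addrC addKr.
  have -> : b + w' - b = w' by rewrite addrC addKr.
  have -> : a + w - b = w + (a - b) by rewrite addrAC addrC.
  have -> : b + w' - a = w' + (-1) *: (a - b) by rewrite scaleN1r opprB addrAC addrC.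
  rewrite -[- w]scaleN1r -[- g b]scaleN1r !dotvE !enormE.
  rewrite !(fdotDl, fdotDr, fdotZl, fdotZr); lra.
have I2 : fdot (g a - g b) (a - b) <= G * frob (a - b) ^+ 2.
  have := fsmooth _ _ Xa Xb; have := fsmooth _ _ Xb Xa.
  have -> : b - a = (-1) *: (a - b) by rewrite scaleN1r opprB.
  rewrite -[- g b]scaleN1r !dotvE !enormE frobZ normrN1 mul1r.
  rewrite !(fdotDl, fdotDr, fdotZl, fdotZr); lra.
have sq u w : X u -> X w -> frob (u - w) ^+ 2 <= M ^+ 2.
  by move=> Xu Xw; rewrite ler_pXn2r ?nnegrE ?frob_ge0// -enormE Xdiam.
have sz := sq _ _ Xz Xa; have sy := sq _ _ Xy Xb.
have tM : tau * M = frob (a - b) by rewrite /tau divfK// gt_eqF.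
clearbody tau.
move: I1; rewrite !(frobZ_ge0 _ _ (ltW tau0)) -scalerBr.
have -> : y - b - (z - a) = (y - z) + (a - b) 
  by rewrite opprB [a - z]addrC addrACA [- b + a]addrC.
rewrite fdotZr fdotDr !exprMn => I1.
rewrite -(ler_pM2l tau0).
have -> : tau * (2 * G * M * frob (a - b)) = G * frob (a - b) ^+ 2 + G * (tau * M) ^+ 2.
  by rewrite tM -tM; ring.
have I3 : (1 - tau) * fdot (g a - g b) (a - b) <= G * frob (a - b) ^+ 2.
  have : (1 - tau) * fdot (g a - g b) (a - b) <= (1 - tau) * (G * frob (a - b) ^+ 2).
    by rewrite ler_wpM2l// subr_ge0.
  have : 0 <= tau * (G * frob (a - b) ^+ 2).
    by apply: mulr_ge0; [exact: ltW | rewrite mulr_ge0 ?sqr_ge0].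
  lra.
have I4 : G / 2 * (tau ^+ 2 * frob (z - a) ^+ 2 + tau ^+ 2 * frob (y - b) ^+ 2) <=
    G * (tau * M) ^+ 2.
  have -> : G * (tau * M) ^+ 2 = G / 2 * (tau ^+ 2 * M ^+ 2 + tau ^+ 2 * M ^+ 2) by field.
  by rewrite ler_wpM2l ?divr_ge0// lerD// ler_wpM2l ?sqr_ge0.
lra.
Qed.
End GradientBounds.

(** Sum the recursion and shift the index; the missing last term [s * a K] is nonnegative. It serves
    inside a round for disagreement and tracking errors, and across rounds for disagreement and
    optimality gaps. *)
Lemma contraction_sum_le {R : realType} (s : R) (a b : nat -> R) (K : nat) :
  0 <= s -> 0 <= a K -> (0 < K)%N ->
  (forall k, (1 <= k < K)%N -> a k.+1 <= s * a k + b k) ->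
  (1 - s) * \sum_(1 <= k < K.+1) a k <= a 1%N + \sum_(1 <= k < K) b k.
Proof.
move=> s0 aK K0 h.
have e : \sum_(1 <= k < K.+1) a k = a 1%N + \sum_(1 <= k < K) a k.+1.
  by rewrite big_ltn// big_add1.
have h1 : \sum_(1 <= k < K) a k.+1 <= s * \sum_(1 <= k < K) a k + \sum_(1 <= k < K) b k.
  by rewrite mulr_sumr -big_split/=; exact: ler_sum_nat.
have h2 : \sum_(1 <= k < K.+1) a k = \sum_(1 <= k < K) a k + a K by rewrite big_nat_recr.
have saK : 0 <= s * a K by rewrite mulr_ge0.
rewrite mulrBl mul1r {1}e h2; lra.
Qed.

(** [Fsum] with the round already fixed, so that one round is analysed without a time index. *)
Definition Ftot {R : realType} {n d : nat} (f : 'I_n -> 'rV[R]_d -> R) (y : 'rV[R]_d) : R :=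
  \sum_i f i y.

(** * The inner loop of one round, with agents stacked as matrix rows *)

Section InnerLoop.
Context {R : realType} {n d : nat} {A : 'M[R]_n} {zeta : R} {X : set 'rV[R]_d}.
Context {M L G : R} {f : 'I_n -> 'rV[R]_d -> R} {g : 'I_n -> 'rV[R]_d -> 'rV[R]_d}.
Context {xs : 'rV[R]_d} {K : nat} {al : R} {Xk Xh Gh V : nat -> 'M[R]_(n, d)}.
Variable i0 : 'I_n.
Hypotheses (zeta_gt0 : 0 < zeta) (A1 : A1_matrix zeta A) (Xconv : convex_subset X)
  (Xdiam : forall y z, X y -> X z -> enorm (y - z) <= M)
  (L0 : 0 <= L) (G0 : 0 <= G) (M0 : 0 <= M)
  (flip : forall i y z, X y -> X z -> `|f i y - f i z| <= L * enorm (y - z))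
  (fsmooth : forall i y z, X y -> X z ->
     f i y - f i z <= dotv (g i z) (y - z) + G / 2 * enorm (y - z) ^+ 2)
  (fconv : forall i, convex_fun_on X (f i))
  (fgrad : forall i, is_gradient_on X (f i) (g i)).
Hypotheses (xsX : X xs) (al01 : 0 <= al <= 1) (X1 : forall i, X (row i (Xk 1%N))).

Local Notation Gr k := (\matrix_i g i (row i (Xh k))).

Hypotheses (XhE : forall k, (1 <= k <= K)%N -> Xh k = A *m Xk k)
  (Gh1 : (1 <= K)%N -> Gh 1%N = A *m Gr 1%N)
  (GhS : forall k, (1 <= k < K)%N -> Gh k.+1 = A *m (Gh k + Gr k.+1 - Gr k))
  (VX : forall k i, (1 <= k <= K)%N -> X (row i (V k)))
  (Vmin : forall k i, (1 <= k <= K)%N -> forall y, X y ->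
     fdot (row i (V k)) (row i (Gh k)) <= fdot y (row i (Gh k)))
  (XkS : forall k, (1 <= k <= K)%N -> Xk k.+1 = Xh k + al *: (V k - Xh k)).

Local Notation s := (sigma1 n zeta).
Let s_gt0 : 0 < s. Proof. by have /andP[] := sigma1_itv zeta_gt0 A1 i0. Qed.
Let s_lt1 : s < 1. Proof. by have /andP[] := sigma1_itv zeta_gt0 A1 i0. Qed.
Let n_gt0 : 0 < n%:R :> R. Proof. by rewrite ltr0n (leq_ltn_trans _ (ltn_ord i0)). Qed.

Lemma mixing_in (Y : 'M[R]_(n, d)) : (forall i, X (row i Y)) -> forall i, X (row i (A *m Y)).
Proof.
move=> YX i; rewrite row_mul mulmx_sum_row.
have [A0 [_ [_ [_ [Ar _]]]]] := A1.
by apply: convex_comb => // [j|]; rewrite ?mxE//; under eq_bigr do rewrite mxE.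
Qed.

Lemma avgr_in (Y : 'M[R]_(n, d)) : (forall i, X (row i Y)) -> X (avgr Y).
Proof.
move=> YX; rewrite /avgr scaler_sumr; apply: convex_comb => //.
by rewrite sumr_const card_ord -[n%:R^-1 *+ n]mulr_natl divff// gt_eqF.
Qed.

Lemma Xk_in k : (1 <= k <= K.+1)%N -> forall i, X (row i (Xk k)).
Proof.
elim: k => // -[|k] IH hk i; first exact: X1.
have hk' : (1 <= k.+1 <= K)%N by [].
rewrite XkS// linearD linearZ linearB/= XhE//; apply: convex_step => //; last exact: VX.
by apply: mixing_in; apply: IH; exact: ltnW hk.
Qed.

Lemma Xh_in k : (1 <= k <= K)%N -> forall i, X (row i (Xh k)).
Proof.
move=> hk i; rewrite XhE//; apply: mixing_in; apply: Xk_in.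
by case/andP: hk => -> /= hk; rewrite ltnW.
Qed.

Lemma frob_rows_le (Y : 'M[R]_(n, d)) :
  (forall i, frob (row i Y) <= M) -> frob Y <= n%:R * M.
Proof.
move=> h; rewrite (le_trans (frob_le_sum_rows _))//.
by rewrite (le_trans (ler_sum _ (fun i _ => h i)))// sumr_const card_ord [n%:R * _]mulr_natl.
Qed.

Lemma frob_dev_in (Y : 'M[R]_(n, d)) : (forall i, X (row i Y)) -> frob (dev Y) <= n%:R * M.
Proof.
move=> YX; apply: frob_rows_le => i; rewrite row_dev -enormE.
by apply: Xdiam => //; exact: avgr_in.
Qed.

Lemma dev_XkS k : (1 <= k <= K)%N ->
  frob (dev (Xk k.+1)) <= frob (dev (Xh k)) + al * (n%:R * M).
Proof.
move=> hk; have /andP[al0 al1] := al01.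
have -> : Xk k.+1 = (1 - al) *: Xh k + al *: V k.
  by rewrite XkS// scalerBr scalerBl scale1r addrA addrAC.
rewrite devD !devZ (le_trans (ler_frobD _ _))// !frobZ_ge0// ?subr_ge0//.
rewrite lerD// ?ler_wpM2l// ?frob_dev_in//; last by move=> i; exact: VX.
by rewrite ler_piMl ?frob_ge0// gerBl.
Qed.

Lemma dev_Xh_le k : (1 <= k <= K)%N -> frob (dev (Xh k)) <= s * frob (dev (Xk k)).
Proof. by move=> hk; rewrite XhE// frob_dev_mul. Qed.

Lemma dev_XhS k : (1 <= k < K)%N ->
  frob (dev (Xh k.+1)) <= s * frob (dev (Xh k)) + al * (n%:R * M).
Proof.
move=> /andP[k1 kK]; have /andP[al0 al1] := al01.
have hk : (1 <= k <= K)%N by rewrite k1 ltnW.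
rewrite (le_trans (dev_Xh_le k.+1 _))//.
have := dev_XkS _ hk; rewrite -(ler_pM2l s_gt0) => /le_trans; apply.
rewrite mulrDr lerD2l ler_piMl ?mulr_ge0 ?ler0n//; exact: ltW.
Qed.

Lemma dev_Xh1 : (1 <= K)%N -> frob (dev (Xh 1%N)) <= n%:R * M.
Proof.
move=> K1; rewrite (le_trans (dev_Xh_le 1%N _))//.
rewrite (le_trans _ (frob_dev_in _ X1))// ler_piMl ?frob_ge0//; exact: ltW.
Qed.

(** In a round [K * al] is [1 / rho], so the total disagreement over the loop is bounded uniformly
    in [K]. *)
Lemma sum_dev_Xh : (1 <= K)%N ->
  (1 - s) * \sum_(1 <= k < K.+1) frob (dev (Xh k)) <= n%:R * M + K%:R * al * (n%:R * M).
Proof.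
move=> K1; have /andP[al0 _] := al01.
have := contraction_sum_le s (fun k => frob (dev (Xh k))) (fun=> al * (n%:R * M)) K.
move=> /(_ (ltW s_gt0) (frob_ge0 _) K1 dev_XhS) /le_trans; apply.
rewrite lerD ?dev_Xh1// sumr_const_nat -[_ *+ (K - 1)]mulr_natl -mulrA ler_wpM2r//.
  by rewrite !mulr_ge0 ?ler0n.
by rewrite ler_nat leq_subr.
Qed.

(** The displacement is the effect of mixing [Xh k], governed by its deviation, plus a mixed
    Frank-Wolfe step of length proportional to [al]. *)
Lemma Xh_diff k : (1 <= k < K)%N ->
  frob (Xh k.+1 - Xh k) <= 2 * frob (dev (Xh k)) + al * (n%:R * M).
Proof.
move=> /andP[k1 kK]; have /andP[al0 al1] := al01.
have hk : (1 <= k <= K)%N by rewrite k1 ltnW.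
have -> : Xh k.+1 - Xh k = (A *m Xh k - Xh k) + al *: (A *m (V k - Xh k)).
  by rewrite [Xh k.+1]XhE// XkS// mulmxDr -scalemxAr addrAC.
rewrite (le_trans (ler_frobD _ _))// lerD ?(frob_mul_sub A1)//.
rewrite frobZ_ge0// ler_wpM2l// (le_trans (frob_mul_le A1 _))//.
apply: frob_rows_le => i; rewrite linearB/= -enormE.
by apply: Xdiam; [exact: VX|exact: Xh_in].
Qed.

Lemma sum_Xh_diff : (1 <= K)%N ->
  \sum_(1 <= k < K) frob (Xh k.+1 - Xh k) <=
  2 * \sum_(1 <= k < K.+1) frob (dev (Xh k)) + K%:R * al * (n%:R * M).
Proof.
move=> K1; have /andP[al0 _] := al01.
rewrite (le_trans (ler_sum_nat Xh_diff))// big_split/= -mulr_sumr lerD//.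
  by rewrite ler_wpM2l// big_nat_recr//= lerDl frob_ge0.
rewrite sumr_const_nat -[_ *+ (K - 1)]mulr_natl -mulrA ler_wpM2r ?ler_nat ?leq_subr//.
by rewrite !mulr_ge0 ?ler0n.
Qed.

(* Gradients are only controlled against directions [y - z] with [y, z] in [X]:
   components orthogonal to the affine hull of [X] are unconstrained by the
   hypotheses. The bound below is uniform over such directions. *)
Fixpoint tracking_bound (k : nat) : R :=
  if k is k'.+1 then
    s * (tracking_bound k' + (if k' is 0 then 0 else 2 * G * M * frob (Xh k - Xh k')))
  else n%:R * (2 * L * M).

Lemma tracking_bound_ge0 k : 0 <= tracking_bound k.
Proof.
elim: k => [|k IH] /=; first by rewrite !mulr_ge0 ?ler0n.
rewrite mulr_ge0 ?(ltW s_gt0)// addr_ge0//; case: k {IH} => // k.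
by rewrite !mulr_ge0 ?frob_ge0.
Qed.

Lemma frob_row_scalar (Y : 'M[R]_(n, d)) (u : 'rV[R]_d) i :
  frob (row i (Y *m u^T)) = `|fdot (row i Y) u|.
Proof.
rewrite /frob fdotE !big_ord1 -expr2 sqrtr_sqr; congr `|_|.
by rewrite row_mul /fdot /mxtrace big_ord1.
Qed.

(** Multiplying by the transposed direction turns the estimates into a column of scalars. Mixing
    contracts its deviation by [sigma1], and the gradient increment is controlled row by row by the
    displacement. Index 0 of [tracking_bound] stands for the unmixed first gradients. *)
Lemma dev_Gh_le k y z : (1 <= k <= K)%N -> X y -> X z ->
  frob (dev (Gh k *m (y - z)^T)) <= tracking_bound k.
Proof.
move=> + Xy Xz; elim: k => // -[|k] IH hk.
  rewrite Gh1 ?(andP hk).2// -mulmxA (le_trans (frob_dev_mul zeta_gt0 A1 i0 _))//=.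
  rewrite addr0 ler_wpM2l ?(ltW s_gt0)// (le_trans (frob_dev_le i0 _))//.
  rewrite (le_trans (frob_le_sum_rows _))//.
  have b i : frob (row i (Gr 1%N *m (y - z)^T)) <= 2 * L * M.
    rewrite frob_row_scalar rowK.
    exact: (gradient_dot_le Xconv Xdiam L0 G0 (flip i) (fsmooth i) (fconv i) (fgrad i)
      _ _ _ (Xh_in _ hk _) Xy Xz).
  by rewrite (le_trans (ler_sum _ (fun i _ => b i)))// sumr_const card_ord [n%:R * _]mulr_natl.
have kK : (1 <= k.+1 < K)%N by [].
have hk' : (1 <= k.+1 <= K)%N by exact: ltnW hk.
rewrite GhS// -mulmxA (le_trans (frob_dev_mul zeta_gt0 A1 i0 _))//.
rewrite [tracking_bound _]/= -/(tracking_bound k.+1) ler_wpM2l ?(ltW s_gt0)//.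
rewrite -addrA mulmxDl devD (le_trans (ler_frobD _ _))// lerD ?IH//.
rewrite (le_trans (frob_dev_le i0 _))// frob_le_rows ?mulr_ge0// => i.
rewrite frob_row_scalar !linearB/= !rowK.
have Xa := Xh_in _ hk i; have Xb := Xh_in _ hk' i.
have lip := gradient_lipschitz Xconv Xdiam G0 M0 (fsmooth i) (fconv i) (fgrad i)
  _ _ _ _ Xa Xb.
rewrite ler_norml lip// andbT lerNl -[X in X <= _]mulN1r -fdotZr scaleN1r opprB.
exact: lip.
Qed.

Lemma sum_tracking_bound : (1 <= K)%N ->
  (1 - s) * \sum_(1 <= k < K.+1) tracking_bound k <=
  n%:R * (2 * L * M) + 2 * G * M * \sum_(1 <= k < K) frob (Xh k.+1 - Xh k).
Proof.
move=> K1.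
have := contraction_sum_le s tracking_bound (fun k => 2 * G * M * frob (Xh k.+1 - Xh k)) K.
move=> /(_ (ltW s_gt0) (tracking_bound_ge0 K) K1) H; rewrite [X in _ <= _ + X]mulr_sumr.
apply: (le_trans (H _)).
  move=> [//|k] /andP[_ kK]; rewrite [tracking_bound _]/= -/(tracking_bound k.+1) mulrDr lerD2l.
  by rewrite ler_piMl ?(ltW s_lt1)// !mulr_ge0 ?frob_ge0.
rewrite lerD2r/= addr0 ler_piMl ?(ltW s_lt1)// !mulr_ge0 ?ler0n//.
Qed.

(** The invariant of gradient tracking: mixing preserves averages and the corrections telescope. *)
Lemma avgr_Gh k : (1 <= k <= K)%N -> avgr (Gh k) = avgr (Gr k).
Proof.
elim: k => // -[|k] IH hk; first by rewrite Gh1 ?(andP hk).2// (avgr_mul A1 i0).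
rewrite GhS// (avgr_mul A1 i0) -scaleN1r !avgrD avgrZ IH ?(ltnW hk)//.
by rewrite scaleN1r addrAC subrr add0r.
Qed.

Local Notation gap k := (Ftot f (avgr (Xk k)) - Ftot f xs).

(** Smoothness bounds the step from [y] towards [w], and convexity turns the slope along [xs - y]
    into minus the gap. There remains the slope along [w - xs], positive only through disagreement
    and tracking errors. *)
Lemma gapS k : (1 <= k <= K)%N ->
  gap k.+1 <= (1 - al) * gap k
    + al * (n%:R * (2 * G * M * frob (dev (Xh k)) + tracking_bound k))
    + n%:R * (G / 2 * M ^+ 2) * al ^+ 2.
Proof.
move=> hk; have /andP[al0 al1] := al01.
have Xhk := Xh_in _ hk.
set y := avgr (Xk k).
have yE : avgr (Xh k) = y by rewrite XhE// (avgr_mul A1 i0).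
have Xy : X y by rewrite -yE; exact: avgr_in.
set w := avgr (V k).
have Xw : X w by apply: avgr_in => i; exact: VX.
have y'E : avgr (Xk k.+1) = y + al *: (w - y).
  by rewrite XkS// avgrD avgrZ avgrD -scaleN1r avgrZ yE scaleN1r.
have Xy' : X (y + al *: (w - y)) by exact: convex_step.
pose gF := \sum_i g i y.
have gF_dot u : fdot gF u = \sum_i fdot (g i y) u by exact: fdot_suml.
have up : Ftot f (y + al *: (w - y)) - Ftot f y <=
    al * fdot gF (w - y) + n%:R * (G / 2 * M ^+ 2) * al ^+ 2.
  rewrite /Ftot -sumrB -fdotZr gF_dot.
  have e : n%:R * (G / 2 * M ^+ 2) * al ^+ 2 = \sum_(i < n) G / 2 * M ^+ 2 * al ^+ 2.
    by rewrite sumr_const card_ord -[(_ * _) *+ _]mulr_natl !mulrA.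
  rewrite e -big_split/=; apply: ler_sum => i _.
  apply: (le_trans (fsmooth i _ _ Xy' Xy)).
  have -> : y + al *: (w - y) - y = al *: (w - y) by rewrite addrC addKr.
  rewrite dotvE lerD2l enormE frobZ_ge0// exprMn [al ^+ 2 * _]mulrC.
  rewrite [leLHS]mulrA ler_wpM2r ?sqr_ge0// ler_wpM2l ?divr_ge0//.
  rewrite ler_pXn2r ?nnegrE ?frob_ge0// -enormE.
  exact: Xdiam.
have lower : fdot gF (xs - y) <= Ftot f xs - Ftot f y.
  rewrite gF_dot /Ftot -sumrB; apply: ler_sum => i _.
  exact: (gradient_ineq (fconv i) (fgrad i)).
(* Agent [i] minimises against its own estimate. Passing to the average estimate costs
   [tracking_bound k]; passing from gradients at the agents' points to gradients at [y] costs the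
   disagreement. *)
have main i : fdot gF (row i (V k) - xs) <=
    n%:R * (2 * G * M * frob (dev (Xh k)) + tracking_bound k).
  have Xv := VX _ i hk.
  set u := row i (V k) - xs.
  have h1 : fdot (row i (Gh k)) u <= 0.
    have := Vmin _ i hk _ xsX.
    rewrite /u -[- xs]scaleN1r fdotDr fdotZr ![fdot (row i (Gh k)) _]fdotC; lra.
  have h2 : fdot (avgr (Gh k)) u <= fdot (row i (Gh k)) u + tracking_bound k.
    have := dev_Gh_le _ _ _ hk Xv xsX; rewrite dev_mulr -/u => h.
    have := le_trans (frob_row_le _ i) h.
    rewrite frob_row_scalar row_dev -scaleN1r fdotDl fdotZl ler_norml => /andP[+ _].
    lra.
  have h3 : fdot gF u <= n%:R * (2 * G * M * frob (dev (Xh k)))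
      + n%:R * fdot (avgr (Gh k)) u.
    have -> : n%:R * fdot (avgr (Gh k)) u = \sum_j fdot (g j (row j (Xh k))) u.
      rewrite avgr_Gh// /avgr fdotZl mulrA divff ?gt_eqF// mul1r.
      by rewrite fdot_suml; apply: eq_bigr => j _; rewrite rowK.
    have -> : n%:R * (2 * G * M * frob (dev (Xh k))) =
        \sum_(j < n) 2 * G * M * frob (dev (Xh k)).
      by rewrite sumr_const card_ord -[(_ * _) *+ _]mulr_natl.
    rewrite gF_dot -big_split/=; apply: ler_sum => j _.
    have := gradient_lipschitz Xconv Xdiam G0 M0 (fsmooth j) (fconv j) (fgrad j)
      _ _ _ _ Xy (Xhk j) Xv xsX.
    rewrite -/u -[- g _ _]scaleN1r fdotDl fdotZl.
    have : frob (y - row j (Xh k)) <= frob (dev (Xh k)).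
      by rewrite -frobN opprB -yE -row_dev frob_row_le.
    move=> h4 h5.
    have : 2 * G * M * frob (y - row j (Xh k)) <= 2 * G * M * frob (dev (Xh k)).
      by rewrite ler_wpM2l ?mulr_ge0.
    lra.
  apply: (le_trans h3); rewrite mulrDr lerD2l ler_wpM2l ?ler0n//; lra.
(* The direction [w - xs] is the average of the agents' directions. *)
have avgmain : fdot gF (w - xs) <= n%:R * (2 * G * M * frob (dev (Xh k)) + tracking_bound k).
  rewrite -(ler_pM2l n_gt0) -fdotZr.
  have -> : n%:R *: (w - xs) = \sum_i (row i (V k) - xs).
    rewrite sumrB sumr_const card_ord scalerBr scalerA divff ?gt_eqF// scale1r.
    by rewrite scaler_nat.
  rewrite fdotC fdot_suml; under eq_bigr do rewrite fdotC.
  rewrite (le_trans (ler_sum _ (fun i _ => main i)))//.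
  by rewrite sumr_const card_ord [n%:R * (n%:R * _)]mulr_natl.
rewrite y'E -/y.
have e : fdot gF (w - y) = fdot gF (w - xs) + fdot gF (xs - y).
  by rewrite -fdotDr addrA subrK.
have : al * fdot gF (w - y) <= al * (n%:R * (2 * G * M * frob (dev (Xh k)) + tracking_bound k))
    + al * (Ftot f xs - Ftot f y).
  by rewrite -mulrDr ler_wpM2l// e lerD.
move: up; lra.
Qed.

Lemma inner_gap_le :
  gap K.+1 <= (1 - al) ^+ K * gap 1%N
    + al * (n%:R * (2 * G * M * (\sum_(1 <= k < K.+1) frob (dev (Xh k)))
                    + \sum_(1 <= k < K.+1) tracking_bound k))
    + K%:R * (n%:R * (G / 2 * M ^+ 2) * al ^+ 2).
Proof.
have /andP[al0 al1] := al01.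
suff : forall k, (k <= K)%N -> gap k.+1 <= (1 - al) ^+ k * gap 1%N
    + al * (n%:R * (2 * G * M * (\sum_(1 <= l < k.+1) frob (dev (Xh l)))
                    + \sum_(1 <= l < k.+1) tracking_bound l))
    + k%:R * (n%:R * (G / 2 * M ^+ 2) * al ^+ 2) by apply.
elim=> [|k IH] kK; first by rewrite expr0 mul1r !big_geq// !(mulr0, addr0, mul0r).
have hk : (1 <= k.+1 <= K)%N by [].
apply: (le_trans (gapS _ hk)).
have {}IH := IH (ltnW kK).
rewrite (big_nat_recr k.+1 1 (fun l => frob (dev (Xh l))))//.
rewrite (big_nat_recr k.+1 1 tracking_bound)// [(1 - al) ^+ _]exprS -[k.+1%:R]natr1.
set P := \sum_(1 <= l < k.+1) frob (dev (Xh l)) in IH *.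
set Q := \sum_(1 <= l < k.+1) tracking_bound l in IH *.
have a1 : 0 <= 1 - al by rewrite subr_ge0.
have P0 : 0 <= P by apply: sumr_ge0 => l _; exact: frob_ge0.
have Q0 : 0 <= Q by apply: sumr_ge0 => l _; exact: tracking_bound_ge0.
have B1 : 0 <= al * (n%:R * (2 * G * M * P + Q)).
  by rewrite !mulr_ge0 ?ler0n// addr_ge0// !mulr_ge0.
have B2 : 0 <= k%:R * (n%:R * (G / 2 * M ^+ 2) * al ^+ 2).
  by rewrite !mulr_ge0 ?ler0n ?sqr_ge0// invr_ge0.
have := ler_wpM2l a1 IH.
set u := (1 - al) ^+ k * gap 1%N in IH *.
set b1 := al * (n%:R * (2 * G * M * P + Q)) in B1 IH *.
set b2 := k%:R * _ in B2 IH *.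
move=> h.
(* Only the initial gap keeps the factor [1 - al]; errors already accumulated are nonnegative and
   may be left undiscounted. *)
have : (1 - al) * (u + b1 + b2) <= (1 - al) * u + b1 + b2.
  have : 0 <= al * b1 by rewrite mulr_ge0.
  have : 0 <= al * b2 by rewrite mulr_ge0.
  lra.
rewrite -[_ * _ ^+ k * _]mulrA -/u.
have -> : al * (n%:R * (2 * G * M * (P + frob (dev (Xh k.+1))) + (Q + tracking_bound k.+1)))
  = b1 + al * (n%:R * (2 * G * M * frob (dev (Xh k.+1)) + tracking_bound k.+1)).
  by rewrite /b1; ring.
rewrite [(k%:R + 1) * _]mulrDl mul1r -/b2; lra.
Qed.

Lemma inner_dev_le : frob (dev (Xk K.+1)) <=
  s ^+ K * frob (dev (Xk 1%N)) + al * (n%:R * M) / (1 - s).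
Proof.
have /andP[al0 _] := al01.
have B0 : 0 <= al * (n%:R * M) by rewrite !mulr_ge0 ?ler0n.
have s1 : 0 < 1 - s by rewrite subr_gt0.
suff : forall k, (k <= K)%N -> frob (dev (Xk k.+1)) <=
  s ^+ k * frob (dev (Xk 1%N)) + al * (n%:R * M) / (1 - s) by apply.
elim=> [|k IH] kK; first by rewrite expr0 mul1r lerDl divr_ge0// ltW.
have hk : (1 <= k.+1 <= K)%N by [].
apply: (le_trans (dev_XkS _ hk)).
apply: (le_trans (lerD (dev_Xh_le _ hk) (lexx _))).
have := ler_wpM2l (ltW s_gt0) (IH (ltnW kK)).
rewrite exprS -[s * _ ^+ k * _]mulrA.
move: (s ^+ k * _) (al * _) B0 => p B B0 h.
(* The bound is the fixed point of [x |-> s * x + B]. *)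
have : B / (1 - s) = s * (B / (1 - s)) + B by field; rewrite gt_eqF.
lra.
Qed.

End InnerLoop.

(** Matches the sums over the loop with [D1] and [D2]. Here [s^-1] is [Gamma1], [i] is [1 / rho],
    [W] is the sum over initial points in [D1], and [Sa], [Sd], [Sc] are the sums of deviations,
    displacements and tracking bounds. *)
Lemma round_constant_le {R : realType} (nr s r G L M i W Sa Sc Sd : R) :
  1 <= nr -> 0 < s -> s < 1 -> r = (1 - s)^-1 -> 0 <= G -> 0 <= L -> 0 <= M ->
  0 <= i -> nr * M <= W ->
  (1 - s) * Sa <= nr * M + i * (nr * M) ->
  Sd <= 2 * Sa + i * (nr * M) ->
  (1 - s) * Sc <= nr * (2 * L * M) + 2 * G * M * Sd ->
  nr * (2 * G * M * Sa + Sc) <=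
  2 * M * ((2 * nr * s^-1 * G * r + G) * (nr * M + nr * s^-1 * r * W) + nr ^+ 2 * s^-1 * L * r
    + i * (2 * nr ^+ 2 * s^-1 * G * M * r * (nr * s^-1 * r + 3) + 2 * nr * M * G)).
Proof.
move=> n1 s0 s1 rE G0 L0 M0 i0 WnM hSa hSd hSc.
have r0 : 0 < r by rewrite rE invr_gt0 subr_gt0.
have r0' := ltW r0.
have divr x y : (1 - s) * x <= y -> x <= r * y.
  move=> h; rewrite rE mulrC ler_pdivlMr ?subr_gt0// mulrC //.
set g := s^-1.
have g1 : 1 <= g by rewrite invf_ge1// ltW.
have g0 : 0 <= g by exact: le_trans g1.
have n0 : 0 <= nr by exact: le_trans n1.
have {}hSa := divr _ _ hSa; have {}hSc := divr _ _ hSc.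
have GM0 : 0 <= 2 * G * M by rewrite !mulr_ge0.
pose a := r * (nr * M + i * (nr * M)).
have hSd' : Sd <= 2 * a + i * (nr * M) by move: hSa; rewrite -/a; lra.
have hSc' : Sc <= r * (nr * (2 * L * M) + 2 * G * M * (2 * a + i * (nr * M))).
  by apply: (le_trans hSc); rewrite ler_pM2l// lerD2l ler_wpM2l.
have step : nr * (2 * G * M * Sa + Sc) <= nr * (2 * G * M * a +
    r * (nr * (2 * L * M) + 2 * G * M * (2 * a + i * (nr * M)))).
  by rewrite ler_wpM2l// lerD// ler_wpM2l.
apply: (le_trans step).
(* The bound obtained so far is a combination of these three monomials; the target has the same ones
   with extra factors [nr] and [g], both at least 1. *)
pose T1 := nr ^+ 2 * r * G * M; pose T2 := nr ^+ 2 * r ^+ 2 * G * M.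
pose T3 := nr ^+ 2 * r * L.
have T10 : 0 <= T1 by rewrite !mulr_ge0 ?sqr_ge0// ltW.
have T20 : 0 <= T2 by rewrite !mulr_ge0 ?sqr_ge0.
have T30 : 0 <= T3 by rewrite !mulr_ge0 ?sqr_ge0// ltW.
have -> : nr * (2 * G * M * a +
    r * (nr * (2 * L * M) + 2 * G * M * (2 * a + i * (nr * M)))) =
    2 * M * (T1 + 2 * T2 + T3 + i * (2 * T1 + 2 * T2)).
  by rewrite /a /T1 /T2 /T3; ring.
rewrite ler_wpM2l ?mulr_ge0// lerD//; last first.
  rewrite ler_wpM2l//.
  have -> : 2 * nr ^+ 2 * g * G * M * r * (nr * g * r + 3) + 2 * nr * M * G
      = 2 * (nr * g ^+ 2 * T2) + 6 * (g * T1) + 2 * nr * M * G.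
    by rewrite /T1 /T2; ring.
  have : T2 <= nr * g ^+ 2 * T2.
    by rewrite ler_peMl// mulr_ege1// exprn_ege1.
  have : T1 <= g * T1 by rewrite ler_peMl.
  have : 0 <= 2 * nr * M * G by rewrite !mulr_ge0.
  lra.
have h1 : T3 <= nr ^+ 2 * g * L * r.
  have -> : nr ^+ 2 * g * L * r = g * T3 by rewrite /T3; ring.
  by rewrite ler_peMl.
rewrite lerD//.
apply: (@le_trans _ _ ((2 * nr * g * G * r + G) * (nr * g * r * (nr * M)))).
  have -> : (2 * nr * g * G * r + G) * (nr * g * r * (nr * M))
      = 2 * (nr * g ^+ 2 * T2) + g * T1 by rewrite /T1 /T2; ring.
  have : T2 <= nr * g ^+ 2 * T2.
    by rewrite ler_peMl// mulr_ege1// exprn_ege1.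
  have : T1 <= g * T1 by rewrite ler_peMl.
  lra.
rewrite ler_wpM2l ?addr_ge0 ?mulr_ge0 ?(ltW r0)//.
have : nr * g * r * (nr * M) <= nr * g * r * W by rewrite ler_wpM2l ?mulr_ge0 ?(ltW r0).
have : 0 <= nr * M by rewrite mulr_ge0.
lra.
Qed.

(** * One round in the variables of the algorithm *)

Section Round.
Context {R : realType} {n d : nat} {A : 'M[R]_n} {zeta : R} {X : set 'rV[R]_d}.
Context {M L G : R} {f : 'I_n -> 'rV[R]_d -> R} {g : 'I_n -> 'rV[R]_d -> 'rV[R]_d}.
Context {xs : 'rV[R]_d} {K : nat} {rho : R}.
Context {xk xh gb gh v : nat -> 'I_n -> 'rV[R]_d}.
Variable i0 : 'I_n.
Hypotheses (zeta_gt0 : 0 < zeta) (A1 : A1_matrix zeta A) (Xconv : convex_subset X)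
  (Xdiam : forall y z, X y -> X z -> enorm (y - z) <= M)
  (L0 : 0 <= L) (G0 : 0 <= G) (M0 : 0 <= M)
  (flip : forall i y z, X y -> X z -> `|f i y - f i z| <= L * enorm (y - z))
  (fsmooth : forall i y z, X y -> X z ->
     f i y - f i z <= dotv (g i z) (y - z) + G / 2 * enorm (y - z) ^+ 2)
  (fconv : forall i, convex_fun_on X (f i))
  (fgrad : forall i, is_gradient_on X (f i) (g i)).
Hypotheses (xsX : X xs) (xs_min : forall y, X y -> Ftot f xs <= Ftot f y)
  (rho1 : 1 <= rho) (K1 : (1 <= K)%N).
Hypotheses (xk1 : forall i, X (xk 1%N i))
  (xhE : forall k i, (1 <= k <= K)%N -> xh k i = \sum_j A i j *: xk k j)
  (gb1 : forall i, gb 1%N i = g i (xh 1%N i))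
  (gbE : forall k i, (2 <= k <= K)%N ->
     gb k i = gh k.-1 i + g i (xh k i) - g i (xh k.-1 i))
  (ghE : forall k i, (1 <= k <= K)%N -> gh k i = \sum_j A i j *: gb k j)
  (vE : forall k i, (1 <= k <= K)%N ->
     X (v k i) /\ forall y, X y -> dotv (v k i) (gh k i) <= dotv y (gh k i))
  (xkS : forall k i, (1 <= k <= K)%N ->
     xk k.+1 i = xh k i + (rho * K%:R)^-1 *: (v k i - xh k i)).

Let al := (rho * K%:R)^-1.
Local Notation mx x := (\matrix_(i < n) (x i : 'rV[R]_d)).

Let mx_mul (x y : 'I_n -> 'rV[R]_d) :
  (forall i, x i = \sum_j A i j *: y j) -> mx x = A *m mx y.
Proof.
move=> h; apply/row_matrixP => i; rewrite rowK row_mul mulmx_sum_row h.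
by apply: eq_bigr => j _; rewrite mxE rowK.
Qed.

Let K_gt0 : 0 < K%:R :> R. Proof. by rewrite ltr0n. Qed.
Let rho_gt0 : 0 < rho. Proof. exact: lt_le_trans rho1. Qed.

Let al01 : 0 <= al <= 1.
Proof.
rewrite invr_ge0 mulr_ge0 ?(ltW rho_gt0) ?ler0n//= invf_le1 ?mulr_gt0//.
by rewrite mulr_ege1// ler1n.
Qed.

Let X1 i : X (row i (mx (xk 1%N))). Proof. by rewrite rowK. Qed.

Let XhE k : (1 <= k <= K)%N -> mx (xh k) = A *m mx (xk k).
Proof. by move=> hk; apply: mx_mul => i; rewrite xhE. Qed.

Let XkS k : (1 <= k <= K)%N ->
  mx (xk k.+1) = mx (xh k) + al *: (mx (v k) - mx (xh k)).
Proof.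
move=> hk; apply/row_matrixP => i.
by rewrite linearD linearZ linearB/= !rowK xkS.
Qed.

Local Notation Gr k := (\matrix_(i < n) g i (row i (mx (xh k)))).

Let Gh1 : (1 <= K)%N -> mx (gh 1%N) = A *m Gr 1%N.
Proof.
move=> hK; rewrite (mx_mul (gh 1%N) (gb 1%N)); last by move=> i; rewrite ghE.
by congr (_ *m _); apply/row_matrixP => i; rewrite !rowK gb1.
Qed.

Let GhS k : (1 <= k < K)%N -> mx (gh k.+1) = A *m (mx (gh k) + Gr k.+1 - Gr k).
Proof.
move=> /andP[k1 kK]; rewrite (mx_mul (gh k.+1) (gb k.+1)); last by move=> i; rewrite ghE.
congr (_ *m _); apply/row_matrixP => i.
by rewrite linearB linearD/= !rowK gbE//= ltnS k1.
Qed.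

Let VX k i : (1 <= k <= K)%N -> X (row i (mx (v k))).
Proof. by move=> hk; rewrite rowK; case: (vE k i hk). Qed.

Let Vmin k i : (1 <= k <= K)%N -> forall y, X y ->
  fdot (row i (mx (v k))) (row i (mx (gh k))) <= fdot y (row i (mx (gh k))).
Proof. by move=> hk y Xy; rewrite !rowK -!dotvE; case: (vE k i hk) => _; apply. Qed.

Lemma round_in i : X (xk K.+1 i).
Proof.
have := Xk_in A1 Xconv al01 X1 XhE VX XkS K.+1; rewrite leqnn => /(_ isT i).
by rewrite rowK.
Qed.

Lemma round_dev : frob (dev (mx (xk K.+1))) <=
  sigma1 n zeta ^+ K * frob (dev (mx (xk 1%N)))
  + n%:R * M / (rho * (1 - sigma1 n zeta)) / K%:R.
Proof.
have /andP[_ s1] := sigma1_itv zeta_gt0 A1 i0.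
have := inner_dev_le i0 zeta_gt0 A1 Xconv Xdiam M0 al01 XhE VX XkS.
congr (_ <= _ + _); rewrite /al; field.
by rewrite subr_eq0 !gt_eqF.
Qed.

(** The part of [E3] that multiplies [cexp rho]: the error one round adds to the gap, times [K]. *)
Definition round_const (x1 : 'I_n -> 'rV[R]_d) : R :=
  2 * M * (rho^-1 * D1 zeta G L M x1 + (rho ^+ 2)^-1 * D2 n zeta G M)
  + n%:R * G * M ^+ 2 / (2 * rho).

Lemma round_gap (x1 : 'I_n -> 'rV[R]_d) :
  Ftot f (avgr (mx (xk K.+1))) - Ftot f xs <=
  expR (- rho^-1) * (Ftot f (avgr (mx (xk 1%N))) - Ftot f xs) + round_const x1 / K%:R.
Proof.
have /andP[s0 s1] := sigma1_itv zeta_gt0 A1 i0.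
have n1 : 1 <= n%:R :> R by rewrite ler1n (leq_ltn_trans _ (ltn_ord i0)).
have alK : K%:R * al = rho^-1 by rewrite /al; field; rewrite !gt_eqF.
have i0' : 0 <= rho^-1 by rewrite invr_ge0 ltW.
have Sa := sum_dev_Xh i0 zeta_gt0 A1 Xconv Xdiam M0 al01 X1 XhE VX XkS K1.
have Sd := sum_Xh_diff A1 Xconv Xdiam M0 al01 X1 XhE VX XkS K1.
have Sc := sum_tracking_bound (Xh := fun k => mx (xh k)) i0 zeta_gt0 A1 L0 G0 M0 K1.
rewrite alK in Sa Sd.
pose W := \sum_j (enorm (x1 j) + M).
(* This holds for any family [x1], so the initial points of the whole run can be used in every
   round. *)
have WnM : n%:R * M <= W.
  have -> : n%:R * M = \sum_(j < n) M by rewrite sumr_const card_ord mulr_natl.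
  by apply: ler_sum => j _; rewrite lerDr enormE frob_ge0.
have bound : n%:R * (2 * G * M * \sum_(1 <= k < K.+1) frob (dev (mx (xh k)))
      + \sum_(1 <= k < K.+1) tracking_bound (zeta := zeta) (M := M) (L := L) (G := G)
          (Xh := fun k => mx (xh k)) k) <=
    2 * M * (D1 zeta G L M x1 + rho^-1 * D2 n zeta G M).
  exact: (round_constant_le _ _ _ _ _ _ _ _ _ _ _ n1 s0 s1 erefl G0 L0 M0 i0' WnM Sa Sd Sc).
have := inner_gap_le i0 zeta_gt0 A1 Xconv Xdiam L0 G0 M0 flip fsmooth fconv fgrad xsX al01
  X1 XhE Gh1 GhS VX Vmin XkS.
(* Nonnegativity of the initial gap allows its factor [(1 - al) ^+ K] to be enlarged to the
   exponential. *)
have h0 : 0 <= Ftot f (avgr (mx (xk 1%N))) - Ftot f xs.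
  by rewrite subr_ge0 xs_min//; apply: (avgr_in i0 Xconv); exact: X1.
move=> /le_trans; apply; rewrite -addrA lerD//.
  rewrite ler_wpM2r//; have /andP[al0 al1] := al01.
  rewrite -alK -mulrN expRM_natl ler_pXn2r// ?nnegrE ?subr_ge0 ?expR_ge0//.
  exact: expR_ge1Dx.
have al0 : 0 <= al by case/andP: al01.
have := ler_wpM2l al0 bound.
set B := n%:R * (_ + _) => hB.
apply: (le_trans (lerD hB (lexx _))).
rewrite /round_const; move: (D1 _ _ _ _ _) (D2 _ _ _ _) => d1 d2.
(* The curvature term carries an additional factor [rho^-1], which is at most 1. *)
have -> : K%:R * (n%:R * (G / 2 * M ^+ 2) * al ^+ 2)
    = n%:R * G * M ^+ 2 / (2 * rho) / K%:R * rho^-1.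
  by rewrite /al; field; rewrite !gt_eqF.
have -> : al * (2 * M * (d1 + rho^-1 * d2))
    = 2 * M * (rho^-1 * d1 + (rho ^+ 2)^-1 * d2) / K%:R.
  by rewrite /al; field; rewrite !gt_eqF.
rewrite [leRHS]mulrDl lerD2l ler_piMr ?invf_le1//.
by rewrite !mulr_ge0 ?ler0n ?invr_ge0 ?mulr_ge0 ?ler0n ?(ltW rho_gt0).
Qed.

End Round.

(** * Summation over rounds and the regret bound *)

Lemma variation_le {R : realType} {n d : nat} {X : set 'rV[R]_d} {M L : R}
  {f : nat -> 'I_n -> 'rV[R]_d -> R} (t : nat) (i : 'I_n) (y : 'rV[R]_d) :
  (forall y z, X y -> X z -> enorm (y - z) <= M) -> 0 <= L ->
  (forall t i y z, X y -> X z -> `|f t i y - f t i z| <= L * enorm (y - z)) ->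
  X y ->
  `|f t.+1 i y - f t i y| <=
    \big[Num.max/0]_(i < n) sup [set `|f t.+1 i x - f t i x| | x in X].
Proof.
move=> Xdiam L0 flip Xy.
apply: le_trans (le_bigmax _ _ i); apply: ub_le_sup; last by exists y.
(* [sup] defaults to 0 on an unbounded set, so a bound is exhibited: moving from [y] to [z] changes
   each of the two losses by at most [L * M]. *)
exists (`|f t.+1 i y - f t i y| + 2 * (L * M)) => _ [z Xz <-].
have LM : L * enorm (z - y) <= L * M by rewrite ler_wpM2l// Xdiam.
have := flip t.+1 i _ _ Xz Xy; have := flip t i _ _ Xz Xy.
move: (ler_norm (f t.+1 i y - f t i y)) (lerNnormlW (lexx `|f t.+1 i y - f t i y|)).
rewrite !ler_norml => h1 h2 /andP[h3 h4] /andP[h5 h6].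
apply/andP; split; lra.
Qed.

Lemma round_const_ge0 {R : realType} {n d : nat} {zeta M L G rho : R} {A : 'M[R]_n}
  (x1 : 'I_n -> 'rV[R]_d) (i0 : 'I_n) :
  0 < zeta -> A1_matrix zeta A -> 0 <= M -> 0 <= L -> 0 <= G -> 0 < rho ->
  0 <= @round_const R n d zeta M L G rho x1.
Proof.
move=> zeta0 A1 M0 L0 G0 rho0; have /andP[s0 s1] := sigma1_itv zeta0 A1 i0.
have g0 : 0 <= (sigma1 n zeta)^-1 by rewrite invr_ge0 ltW.
have r0 : 0 <= (1 - sigma1 n zeta)^-1 by rewrite invr_ge0 subr_ge0 ltW.
have rho0' : 0 <= rho^-1 by rewrite invr_ge0 ltW.
have W0 : 0 <= \sum_j (enorm (x1 j) + M).
  by apply: sumr_ge0 => j _; rewrite addr_ge0// enormE frob_ge0.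
have n0 : 0 <= n%:R :> R by rewrite ler0n.
have d1 : 0 <= D1 zeta G L M x1 by rewrite /D1 /Gamma1 !(addr_ge0, mulr_ge0).
have d2 : 0 <= D2 n zeta G M by rewrite /D2 /Gamma1 !(addr_ge0, mulr_ge0).
have r2 : 0 <= (rho ^+ 2)^-1 by rewrite invr_ge0 sqr_ge0.
have r3 : 0 <= (2 * rho)^-1 by rewrite invr_ge0 mulr_ge0// ltW.
by rewrite /round_const !(addr_ge0, mulr_ge0).
Qed.

Theorem theorem1 (R : realType) (n d : nat)
  (A : nat -> 'M[R]_n) (zeta : R)
  (X : set 'rV[R]_d) (M L G : R)
  (f : nat -> 'I_n -> 'rV[R]_d -> R) (grad : nat -> 'I_n -> 'rV[R]_d -> 'rV[R]_d)
  (xstar : nat -> 'rV[R]_d)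
  (K : nat -> nat) (rho : R) (T : nat)
  (x : nat -> 'I_n -> 'rV[R]_d)
  (xk xh gb gh v : nat -> nat -> 'I_n -> 'rV[R]_d) :
  (* (A1) *)
  0 < zeta -> (forall t, A1_matrix zeta (A t)) ->
  (* (A2) *)
  convex_subset X -> compact X -> (forall y z, X y -> X z -> enorm (y - z) <= M) ->
  (* (A3), (A4) *)
  0 <= L -> 0 <= G -> 0 <= M ->
  (forall t i y z, X y -> X z -> `|f t i y - f t i z| <= L * enorm (y - z)) ->
  (forall t i y z, X y -> X z ->
     f t i y - f t i z <= dotv (grad t i z) (y - z) + G / 2 * enorm (y - z) ^+ 2) ->
  (* losses convex and differentiable on X with gradient grad *)
  (forall t i, convex_fun_on X (f t i)) ->
  (forall t i, is_gradient_on X (f t i) (grad t i)) ->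
  (* minimizers of F_t *)
  (forall t, X (xstar t) /\ forall y, X y -> Fsum f t (xstar t) <= Fsum f t y) ->
  (* step sizes *)
  1 <= rho -> (forall t, (1 <= t)%N -> (2 <= K t)%N) ->
  (forall t, (1 <= t)%N -> (K t <= K t.+1)%N) ->
  (* Algorithm DOMFW, alpha_t = 1 / (rho K_t) *)
  (forall i, X (x 1%N i)) ->
  (forall t i, (1 <= t <= T)%N -> xk t 1%N i = x t i) ->
  (forall t k i, (1 <= t <= T)%N -> (1 <= k <= K t)%N ->
     xh t k i = \sum_(j < n) A t i j *: xk t k j) ->
  (forall t i, (1 <= t <= T)%N -> gb t 1%N i = grad t i (xh t 1%N i)) ->
  (forall t k i, (1 <= t <= T)%N -> (2 <= k <= K t)%N ->
     gb t k i = gh t k.-1 i + grad t i (xh t k i) - grad t i (xh t k.-1 i)) ->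
  (forall t k i, (1 <= t <= T)%N -> (1 <= k <= K t)%N ->
     gh t k i = \sum_(j < n) A t i j *: gb t k j) ->
  (forall t k i, (1 <= t <= T)%N -> (1 <= k <= K t)%N ->
     X (v t k i) /\ forall y, X y -> dotv (v t k i) (gh t k i) <= dotv y (gh t k i)) ->
  (forall t k i, (1 <= t <= T)%N -> (1 <= k <= K t)%N ->
     xk t k.+1 i = xh t k i + (rho * (K t)%:R)^-1 *: (v t k i - xh t k i)) ->
  (forall t i, (1 <= t <= T)%N -> x t.+1 i = xk t (K t).+1 i) ->
  (2 <= T)%N ->
  forall j : 'I_n,
    \sum_(1 <= t < T.+1) Fsum f t (x t j) - \sum_(1 <= t < T.+1) Fsum f t (xstar t)
    <= E1 zeta L M rho (K 1%N) (x 1%N)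
       + E2 n rho * HT X f T
       + E3 zeta G L M rho (K 1%N) (x 1%N) * \sum_(1 <= t < T.+1) ((K t)%:R)^-1.
Proof.
move=> zeta0 A1 Xconv _ Xdiam L0 G0 M0 flip fsmooth fconv fgrad xs_min rho1 K2 Kmono
  x1X xk1 xhE gb1 gbE ghE vE xkS xS T2 j.
pose mx t : 'M[R]_(n, d) := \matrix_(i < n) x t i.
pose y t := avgr (mx t).
pose s := sigma1 n zeta.
have /andP[s0 s1] : 0 < s < 1 := sigma1_itv zeta0 (A1 0%N) j.
pose q := expR (- rho^-1).
have rho0 : 0 < rho by exact: lt_le_trans rho1.
have q1 : q < 1 by rewrite expR_lt1 oppr_lt0 invr_gt0.
have nr1 : 1 <= n%:R :> R by rewrite ler1n (leq_ltn_trans _ (ltn_ord j)).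
have xs_minF t z : X z -> Ftot (f t) (xstar t) <= Ftot (f t) z.
  by move=> Xz; apply: (xs_min t).2.
have K1 t : (1 <= t)%N -> (1 <= K t)%N by move=> /K2; exact: ltnW.
pose C := @round_const R n d zeta M L G rho (x 1%N).
have xX t : (1 <= t <= T.+1)%N -> forall i, X (x t i).
  elim: t => // -[|t] IH ht i; first exact: x1X.
  have tT : (1 <= t.+1 <= T)%N by [].
  rewrite xS//; apply: (round_in (A1 t.+1) Xconv rho1 (K1 t.+1 isT) (xk := xk t.+1)
    (xh := xh t.+1) (gh := gh t.+1) (v := v t.+1)).
  - by move=> i'; rewrite xk1//; apply: IH; exact: ltnW ht.
  - by move=> k i' hk; exact: xhE.
  - by move=> k i' hk; exact: vE.
  - by move=> k i' hk; exact: xkS.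
have yX t : (1 <= t <= T.+1)%N -> X (y t).
  by move=> ht; apply: (avgr_in j Xconv) => i; rewrite rowK; exact: xX.
have mxk1 t : (1 <= t <= T)%N -> \matrix_(i < n) xk t 1%N i = mx t.
  by move=> ht; apply/row_matrixP => i; rewrite !rowK xk1.
have mxkS t : (1 <= t <= T)%N -> \matrix_(i < n) xk t (K t).+1 i = mx t.+1.
  by move=> ht; apply/row_matrixP => i; rewrite !rowK xS.
have xk1X t : (1 <= t <= T)%N -> forall i, X (xk t 1%N i).
  move=> ht i; rewrite xk1//; apply: xX; case/andP: ht => -> /= ht; exact: leqW.
have gap t : (1 <= t <= T)%N -> Ftot (f t) (y t.+1) - Ftot (f t) (xstar t) <=
    q * (Ftot (f t) (y t) - Ftot (f t) (xstar t)) + C / (K t)%:R.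
  move=> ht; have t1 : (1 <= t)%N by case/andP: ht.
  rewrite /y -mxkS// -mxk1//.
  apply: (round_gap j zeta0 (A1 t) Xconv Xdiam L0 G0 M0 (flip t) (fsmooth t) (fconv t)
    (fgrad t) (xs_min t).1 (xs_minF t) rho1 (K1 t t1) (xk := xk t)
    (xh := xh t) (gb := gb t) (gh := gh t) (v := v t)).
  - exact: xk1X.
  - by move=> k i' hk; exact: xhE.
  - by move=> i'; exact: gb1.
  - by move=> k i' hk; exact: gbE.
  - by move=> k i' hk; exact: ghE.
  - by move=> k i' hk; exact: vE.
  - by move=> k i' hk; exact: xkS.
have devS t : (1 <= t <= T)%N -> frob (dev (mx t.+1)) <=
    s ^+ K t * frob (dev (mx t)) + n%:R * M / (rho * (1 - s)) / (K t)%:R.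
  move=> ht; have t1 : (1 <= t)%N by case/andP: ht.
  rewrite -mxkS// -mxk1//.
  apply: (round_dev j zeta0 (A1 t) Xconv Xdiam M0 rho1 (K1 t t1) (xk := xk t)
    (xh := xh t) (gh := gh t) (v := v t)).
  - by move=> k i' hk; exact: xhE.
  - by move=> k i' hk; exact: vE.
  - by move=> k i' hk; exact: xkS.
have C0 : 0 <= C by exact: (round_const_ge0 _ j zeta0 (A1 0%N)).
pose S := \sum_(1 <= t < T.+1) ((K t)%:R : R)^-1.
(* The recursions link [t] to [t.+1] for [t < T], while [S] also contains the term of round [T]. *)
have S_le B : 0 <= B -> \sum_(1 <= t < T) B / (K t)%:R <= B * S.
  move=> B0; rewrite -mulr_sumr ler_wpM2l// [leRHS]big_nat_recr ?(ltnW T2)//=.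
  by rewrite lerDl invr_ge0 ler0n.
pose Hm t := \big[Num.max/0]_(i < n) sup [set `|f t.+1 i z - f t i z| | z in X].
have FH t z : X z -> `|Ftot (f t.+1) z - Ftot (f t) z| <= n%:R * Hm t.
  move=> Xz; rewrite /Ftot -sumrB (le_trans (ler_norm_sum _ _ _))//.
  have -> : n%:R * Hm t = \sum_(i < n) Hm t by rewrite sumr_const card_ord mulr_natl.
  by apply: ler_sum => i _; exact: variation_le Xdiam L0 flip Xz.
have FL t z w : X z -> X w -> Ftot (f t) z - Ftot (f t) w <= n%:R * L * enorm (z - w).
  move=> Xz Xw; rewrite /Ftot -sumrB.
  have h i : true -> f t i z - f t i w <= L * enorm (z - w).
    by move=> _; rewrite (le_trans (ler_norm _))// flip.
  by rewrite (le_trans (ler_sum _ h))// sumr_const card_ord -mulrA [n%:R * _]mulr_natl.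
pose h t := Ftot (f t) (y t) - Ftot (f t) (xstar t).
(* The loss changes by at most [n * Hm t] at [y t.+1] and again at [xstar t.+1], hence the 2; under
   [F_t] the latter point is no better than [xstar t]. *)
have hS t : (1 <= t < T)%N -> h t.+1 <= q * h t + (C / (K t)%:R + 2 * (n%:R * Hm t)).
  move=> /andP[t1 tT]; have ht : (1 <= t <= T)%N by rewrite t1 ltnW.
  have Xy : X (y t.+1) by apply: yX; exact: ltnW tT.
  have := gap t ht; have := FH t _ Xy; have := FH t _ (xs_min t.+1).1.
  have := xs_minF t _ (xs_min t.+1).1.
  rewrite /h !ler_norml => a1 /andP[a2 _] /andP[_ a3] a4; lra.
have sum_h : (1 - q) * \sum_(1 <= t < T.+1) h t <=
    n%:R * L * M + C * S + 2 * n%:R * HT X f T.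
  have hT : 0 <= h T.
    by rewrite subr_ge0; apply: xs_minF; apply: yX; rewrite (ltnW T2) leqnSn.
  apply: (le_trans (contraction_sum_le q h _ T (expR_ge0 _) hT (ltnW T2) hS)).
  rewrite big_split/= addrA lerD//; last by rewrite -!mulr_sumr mulrA.
  rewrite lerD ?S_le// (le_trans (FL 1%N _ _ (yX _ _) (xs_min _).1))//.
  by rewrite ler_wpM2l ?mulr_ge0// Xdiam//; [exact: yX | exact: (xs_min _).1].
(* As [K] is nondecreasing, the first round has the weakest contraction, and its factor serves all
   rounds. *)
pose p := s ^+ K 1%N.
have p1 : p < 1 by rewrite exprn_ilt1 ?(ltW s0)// -lt0n K1.
have pK t : (1 <= t)%N -> s ^+ K t <= p.
  move=> t1; rewrite /p ler_wiXn2l ?(ltW s0) ?(ltW s1)//.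
  elim: t t1 => // -[|t] IH _ //; exact: leq_trans (IH isT) (Kmono t.+1 isT).
pose B := n%:R * M / (rho * (1 - s)).
have B0 : 0 <= B by rewrite divr_ge0 ?mulr_ge0 ?subr_ge0 ?(ltW rho0) ?(ltW s1).
pose N t := frob (dev (mx t)).
have sum_N : (1 - p) * \sum_(1 <= t < T.+1) N t <= N 1%N + B * S.
  have NS t : (1 <= t < T)%N -> N t.+1 <= p * N t + B / (K t)%:R.
    move=> /andP[t1 tT]; have ht : (1 <= t <= T)%N by rewrite t1 ltnW.
    by rewrite (le_trans (devS t ht))// lerD2r ler_wpM2r ?frob_ge0// pK.
  have p0 : 0 <= p by rewrite exprn_ge0// ltW.
  apply: (le_trans (contraction_sum_le p N _ T p0 (frob_ge0 _) (ltnW T2) NS)).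
  by rewrite lerD2l S_le.
have N1 : N 1%N <= \sum_i enorm (x 1%N i).
  rewrite (le_trans (frob_dev_le j _))// (le_trans (frob_le_sum_rows _))//.
  by apply: ler_sum => i _; rewrite rowK enormE.
have regret : \sum_(1 <= t < T.+1) Fsum f t (x t j) - \sum_(1 <= t < T.+1) Fsum f t (xstar t)
    <= n%:R * L * (\sum_(1 <= t < T.+1) N t) + \sum_(1 <= t < T.+1) h t.
  rewrite -sumrB mulr_sumr -big_split/=; apply: ler_sum_nat => t /andP[t1 tT].
  have ht : (1 <= t <= T.+1)%N by rewrite t1 ltnW.
  have := FL t _ _ (xX t ht j) (yX t ht); rewrite /h /Fsum -/(Ftot (f t) _) -/(Ftot (f t) _).
  have : n%:R * L * enorm (x t j - y t) <= n%:R * L * N t.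
    rewrite ler_wpM2l ?mulr_ge0// enormE.
    have -> : x t j - y t = row j (dev (mx t)) by rewrite row_dev rowK.
    exact: frob_row_le.
  lra.
apply: (le_trans regret).
have c_h : \sum_(1 <= t < T.+1) h t <=
    cexp rho * (n%:R * L * M + C * S + 2 * n%:R * HT X f T).
  by rewrite mulrC ler_pdivlMr ?subr_gt0// mulrC.
(* The summed disagreement is brought to the shape of [E1] and [E3] by inserting factors [n] and
   [s^-1], all at least 1. *)
have c_N : n%:R * L * \sum_(1 <= t < T.+1) N t <=
    n%:R ^+ 2 * L * s^-1 / (1 - p) * (\sum_i enorm (x 1%N i))
    + n%:R ^+ 2 * L * M / rho * (n%:R * s^-1 / (s * (1 - s) * (1 - p))) * S.
  have sg1 : 1 <= s^-1 by rewrite invf_ge1// ltW.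
  have S0 : 0 <= S by apply: sumr_ge0 => t _; rewrite invr_ge0 ler0n.
  have s1' : 0 < 1 - s by rewrite subr_gt0.
  have p1' : 0 < 1 - p by rewrite subr_gt0.
  have e0 : 0 <= \sum_i enorm (x 1%N i).
    by apply: sumr_ge0 => i _; rewrite enormE frob_ge0.
  have bN : \sum_(1 <= t < T.+1) N t <= (\sum_i enorm (x 1%N i) + B * S) / (1 - p).
    by rewrite ler_pdivlMr// mulrC (le_trans sum_N)// lerD2r.
  have nL0 : 0 <= n%:R * L by rewrite mulr_ge0.
  apply: (le_trans (ler_wpM2l nL0 bN)).
  have nLp : 0 <= n%:R * L / (1 - p) by rewrite divr_ge0// ltW.
  have -> : n%:R * L * ((\sum_i enorm (x 1%N i) + B * S) / (1 - p)) =
      n%:R * L / (1 - p) * (\sum_i enorm (x 1%N i)) + n%:R * L / (1 - p) * B * S by ring.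
  rewrite lerD//.
    rewrite ler_wpM2r//.
    have -> : n%:R ^+ 2 * L * s^-1 / (1 - p) = n%:R * s^-1 * (n%:R * L / (1 - p)) by ring.
    by rewrite ler_peMl// mulr_ege1.
  rewrite ler_wpM2r//.
  have -> : n%:R ^+ 2 * L * M / rho * (n%:R * s^-1 / (s * (1 - s) * (1 - p))) =
      n%:R * s^-1 * s^-1 * (n%:R * L / (1 - p) * B).
    by rewrite /B; field; rewrite (gt_eqF p1') (gt_eqF s1') (gt_eqF s0) (gt_eqF rho0).
  by rewrite ler_peMl ?mulr_ege1// mulr_ge0.
rewrite /E1 /E2 /E3 -/s -/p /Gamma1 -/s -/S.
move: c_h c_N; rewrite /C /round_const; move: (D1 _ _ _ _ _) (D2 _ _ _ _) => d1 d2.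
set e := \sum_i enorm (x 1%N i); set a := \sum_i enorm (_ - _).
(* The terms of [E1] and [E3] outside [c_h] and [c_N] are nonnegative, so adding those two bounds
   concludes. *)
have a0 : 0 <= n%:R * L * a.
  by rewrite !mulr_ge0//; apply: sumr_ge0 => i _; rewrite enormE frob_ge0.
have b0 : 0 <= n%:R ^+ 2 * L * M / rho * 2 * S.
  rewrite !mulr_ge0 ?sqr_ge0 ?invr_ge0 ?(ltW rho0)//.
  by apply: sumr_ge0 => t _; rewrite invr_ge0 ler0n.
lra.
Qed.
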